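(* Let $k\geq 3$ be a constant integer. Consider a sequence of abelian groups $(G_N)_{N\geq 1}$ such that $|G_N|\geq N^{k-1+c}$ for some constant $c>0$ and all $N\geq k-1$, and a function $S:\mathbb{N}\to\mathbb{R}$. Assume that for every polynomial $T$ there exists a negligible function $\varepsilon$ such that average-case $\textsf{kSUM-Indexing}$ is $(G_N,N,S(n),T(n),\varepsilon(n))$-hard for all $N\geq 1$, where $n=\log N$. Then the function $f$ defined below is a one-way function in the random oracle model with $S$ preprocessing.
   Context: $N=2^n$; $n$ is the security parameter; a function is negligible if it is $o(n^{-d})$ for every constant $d$. Average-case $\textsf{kSUM-Indexing}(G,N)$: a tuple $A=(a_1,\ldots,a_N)$ of elements of $G$ is drawn uniformly at random with replacement; a computationally unbounded $\mathcal{A}_1(A)$ outputs a data structure $D_A$ of size at most $S$; then a query $b$ is drawn uniformly from $Z=\{\sum_{i\in I}a_i: I\subseteq[N],|I|=k-1\}$, and $\mathcal{A}_2(b)$, making at most $T$ queries to $D_A$, outputs $I\subseteq[N]$ with $|I|=k-1$; it succeeds if $\sum_{i\in I}a_i=b$. Average-case $\textsf{kSUM-Indexing}$ is $(G,N,S,T,\varepsilon)$-hard if every such $(S,T)$ algorithm succeeds with probability at most $\varepsilon$ (over the randomness of the algorithm, of $A$, and of $b$). Construction of $f$: for a random oracle $R:[N]\to G_N$ (a uniformly random function), $f^R:[N]^{k-1}\to G_N$ is $f^R(x)=\sum_{i=1}^{k-1}R(x_i)$, with input distribution uniform over tuples $x\in[N]^{k-1}$ with pairwise distinct coordinates. One-way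 function in the random oracle model with $S$ preprocessing: $f^R$ is efficiently computable given oracle access to $R$, and for every two-part adversary $(\mathcal{A}_1,\mathcal{A}_2)$ where $\mathcal{A}_1$ is an arbitrary (unbounded) function of $R$ with output of size at most $S$ and $\mathcal{A}_2$ is probabilistic polynomial time with oracle access to $R$ and to $\mathcal{A}_1(R)$, the probability over $R$, $x$ (from the input distribution) and the adversary's randomness that $f^R\big(\mathcal{A}_2^{R,\mathcal{A}_1(R)}(f^R(x))\big)=f^R(x)$ is negligible in $n$.
   Formalization: The formal theorem also assumes that, for N = 2^n, elements of G_N have unique bit-string encodings of length polynomial in n with deterministic polynomial-time addition; otherwise f need not be efficiently computable (e.g. G_N = (Z/2)^(2^N), S = 0). *)

(* Defs.v *)
From HB Require Import structures.
From mathcomp Require Import all_boot all_order all_algebra.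
From mathcomp Require Import all_classical all_reals all_analysis.

Set Implicit Arguments.
Unset Strict Implicit.
Unset Printing Implicit Defensive.

Import Order.TTheory GRing.Theory Num.Theory.
Import numFieldNormedType.Exports.

Local Open Scope ring_scope.

Definition negligible_fun (R : realType) (eps : nat -> R) : Prop :=
  forall d : nat, (eps =o_\oo (fun n : nat => n%:R ^- d :> R))%classic.

(* Expectation of F under the uniform distribution on A; it is 0 if A is
   empty. *)
Definition avg (R : realType) (T : finType) (A : {set T}) (F : T -> R) : R :=
  (\sum_(x in A) F x) / #|A|%:R.

(** * Average-case kSUM-Indexing *)

(* Adaptive, computationally unbounded algorithms that probe single bits of a
   data structure. *)
Inductive dtree (O : Type) : Type :=
| Answer of O
| Probe of nat & (bool -> dtree O).

Fixpoint depth (O : Type) (t : dtree O) : nat :=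
  match t with
  | Answer _ => 0
  | Probe _ f => (maxn (depth (f false)) (depth (f true))).+1
  end.

Fixpoint eval_dtree (O : Type) (D : bitseq) (t : dtree O) : O :=
  match t with
  | Answer o => o
  | Probe j f => eval_dtree D (f (nth false D j))
  end.

Definition sumset (k N : nat) (G : finZmodType) (a : {ffun 'I_N -> G}) :
    {set G} :=
  [set \sum_(i in I) a i
    | I : {set 'I_N} in [set I : {set 'I_N} | #|I| == k.-1]].

Definition ksum_solution (k N : nat) (G : finZmodType) (a : {ffun 'I_N -> G})
    (b : G) (I : {set 'I_N}) : bool :=
  (#|I| == k.-1) && (\sum_(i in I) a i == b).

(* W with the weights mu is the randomness of the algorithm; S counts bits. *)
Definition ksum_indexing_hard (R : realType) (k : nat) (G : finZmodType)
    (N : nat) (S : R) (T : nat) (eps : R) : Prop :=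
  forall (W : finType) (mu : W -> R)
    (A1 : W -> {ffun 'I_N -> G} -> bitseq)
    (A2 : W -> G -> dtree {set 'I_N}),
  (forall w, 0 <= mu w) -> \sum_(w : W) mu w = 1 ->
  (forall w a, (size (A1 w a))%:R <= S) ->
  (forall w b, (depth (A2 w b) <= T)%N) ->
  \sum_(w : W) mu w *
    avg [set: {ffun 'I_N -> G}] (fun a =>
      avg (sumset k a) (fun b =>
        (ksum_solution k a b (eval_dtree (A1 w a) (A2 w b)))%:R)) <= eps.

(** * Probabilistic oracle programs *)

(* Registers are stacks of bits. Every primitive step inspects or changes one
   bit, except that an oracle call replaces a whole register by the answer (as
   on the answer tape of an oracle Turing machine). Two registers simulate a
   tape, so polynomial time is the same as for multitape oracle machines. *)
Inductive cmd : Type :=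
| Push of nat & bool
| Pop of nat
| Flip of nat                       (* push a fresh random bit *)
| Ask of nat & nat & nat            (* Ask o q a: a := oracle o on query q *)
| Seq of cmd & cmd
| Case of nat & cmd & cmd & cmd     (* top of stack: none, 0, 1 *)
| While of nat & cmd.               (* loop while the stack is nonempty *)

Definition store := nat -> bitseq.

Definition upd (s : store) (r : nat) (v : bitseq) : store :=
  fun r' => if r' == r then v else s r'.

Definition oracles := nat -> bitseq -> bitseq.

(* Commands still to be executed, registers, unused random bits. *)
Record state := State { todo : seq cmd ; regs : store ; coins : bitseq }.

Definition step (O : oracles) (st : state) : state :=
  let: State K s w := st in
  match K with
  | [::] => st
  | Push r b :: K' => State K' (upd s r (b :: s r)) w
  | Pop r :: K' => State K' (upd s r (behead (s r))) w
  | Flip r :: K' => State K' (upd s r (head false w :: s r)) (behead w)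
  | Ask o q a :: K' => State K' (upd s a (O o (s q))) w
  | Seq c1 c2 :: K' => State [:: c1, c2 & K'] s w
  | Case r c c0 c1 :: K' =>
      State ((match s r with
              | [::] => c
              | b :: _ => if b then c1 else c0
              end) :: K') s w
  | While r c :: K' =>
      State (if s r is [::] then K' else [:: c, While r c & K']) s w
  end.

(* Arguments are passed in registers 0, 1, ..., the output is register 0. *)
Definition run (O : oracles) (M : cmd) (args : seq bitseq) (w : bitseq)
    (t : nat) : state :=
  iter t (step O) (State [:: M] (nth [::] args) w).

Definition halted (st : state) : bool := nilp (todo st).

Definition output (st : state) : bitseq := regs st 0%N.

(* The security parameter n is passed in unary. *)
Definition unary (n : nat) : bitseq := nseq n true.

(* Binary, least significant bit first. *)
Definition bits (n i : nat) : bitseq := mkseq (fun j => odd (i %/ 2 ^ j)) n.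

Definition nat_of_bits (s : bitseq) : nat :=
  foldr (fun (b : bool) m => (b + 2 * m)%N) 0%N s.

(** * Groups whose elements are handled as bit strings *)

Definition no_oracle : oracles := fun _ _ => [::].

(* Elements of G_N, N = 2^n, are uniquely represented by strings of length
   polynomial in n, on which addition takes deterministic polynomial time. *)
Definition efficient_groups (G : nat -> finZmodType)
    (enc : forall N, G N -> bitseq) : Prop :=
  [/\ forall n, injective (enc (2 ^ n)%N),
      exists p : {poly nat},
        forall n (g : G (2 ^ n)%N), (size (enc _ g) <= p.[n])%N
    & exists (M : cmd) (p : {poly nat}),
        forall n (g h : G (2 ^ n)%N) (w : bitseq),
        let st := run no_oracle M [:: unary n; enc _ g; enc _ h] w p.[n] in
        halted st /\ output st = enc _ (g + h)].

(** * The function f and one-wayness *)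

Definition ksum_f (k N : nat) (G : finZmodType) (Ro : {ffun 'I_N -> G})
    (x : (k.-1).-tuple 'I_N) : G :=
  \sum_(i < k.-1) Ro (tnth x i).

Definition ksum_inputs (k N : nat) : {set (k.-1).-tuple 'I_N} :=
  [set x : (k.-1).-tuple 'I_N | uniq x].

Definition bits_tuple (k n : nat) (x : (k.-1).-tuple 'I_(2 ^ n)) : bitseq :=
  flatten [seq bits n i | i : 'I_(2 ^ n) <- x].

Section OneWay.

Variables (R : realType) (k : nat).
Variables (G : nat -> finZmodType) (enc : forall N, G N -> bitseq).

(* Oracle 0 is the random oracle, on n-bit inputs; oracle 1 gives random
   access to the advice string D, with addresses in binary. *)
Definition rom_oracles (n : nat) (Ro : {ffun 'I_(2 ^ n) -> G (2 ^ n)%N})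
    (D : bitseq) : oracles :=
  fun o q =>
    match o with
    | 0 => if [pick i : 'I_(2 ^ n) | bits n i == q] is Some i
           then enc (Ro i) else [::]
    | 1 => [:: nth false D (nat_of_bits q)]
    | _ => [::]
    end.

Definition ksum_f_efficient : Prop :=
  exists (M : cmd) (p : {poly nat}),
    forall n (Ro : {ffun 'I_(2 ^ n) -> G (2 ^ n)%N})
      (x : (k.-1).-tuple 'I_(2 ^ n)) (w : bitseq),
    let st := run (rom_oracles Ro [::]) M [:: unary n; bits_tuple x] w p.[n] in
    halted st /\ output st = enc (ksum_f Ro x).

(* Running time at most p(n) for all oracles, inputs and coin tosses. *)
Definition ppt (A2 : cmd) (p : {poly nat}) : Prop :=
  forall n (Ro : {ffun 'I_(2 ^ n) -> G (2 ^ n)%N}) (D : bitseq)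
    (b : G (2 ^ n)%N) (w : bitseq),
  halted (run (rom_oracles Ro D) A2 [:: unary n; enc b] w p.[n]).

Definition inverts (n : nat) (Ro : {ffun 'I_(2 ^ n) -> G (2 ^ n)%N})
    (b : G (2 ^ n)%N) (out : bitseq) : bool :=
  [exists x' : (k.-1).-tuple 'I_(2 ^ n),
    (bits_tuple x' == out) && (ksum_f Ro x' == b)].

(* In time p(n) at most p(n) random bits are consumed. *)
Definition inversion_prob
    (A1 : forall n, {ffun 'I_(2 ^ n) -> G (2 ^ n)%N} -> bitseq)
    (A2 : cmd) (p : {poly nat}) (n : nat) : R :=
  avg [set: {ffun 'I_(2 ^ n) -> G (2 ^ n)%N}] (fun Ro =>
    avg (ksum_inputs k (2 ^ n)) (fun x =>
      avg [set: (p.[n]).-tuple bool] (fun w =>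
        let b := ksum_f Ro x in
        (inverts Ro b
           (output (run (rom_oracles Ro (A1 n Ro)) A2 [:: unary n; enc b]
                      w p.[n])))%:R))).

Definition ksum_f_one_way (S : nat -> R) : Prop :=
  ksum_f_efficient /\
  forall (A1 : forall n, {ffun 'I_(2 ^ n) -> G (2 ^ n)%N} -> bitseq)
    (A2 : cmd) (p : {poly nat}),
  (forall n Ro, (size (A1 n Ro))%:R <= S n) ->
  ppt A2 p ->
  negligible_fun (inversion_prob A1 A2 p).

End OneWay.

(* Main.v *)
(** Write [N = 2^n] and let [L] be the length of the advice; the proof splits on
    whether [L] is below or above [N / poly(n)].

    Short advice: one-wayness is unconditional. For a fixed advice string,
    reprogram the oracle at the first point of the challenge: the inverter wins
    only if it reads that point or if the uniform value [b] happens to be a sum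
    of other oracle values, which has probability at most [N^(k-1) / |G|].
    Conditioning on earlier wins only reveals few oracle entries, so the [t]-th
    moment of the success probability is at most the [t]-th power of this
    bound, and with [t = L + n] a union bound over the [2^L] advice strings
    suffices.

    Long advice: an inverter, which may read the oracle in addition to its
    advice, is turned into a kSUM-Indexing algorithm, which sees nothing but
    its data structure. Only the entries of [a] in [k-1] random residue
    classes modulo a polynomial [q] are kept; the other oracle values are
    replaced by shared randomness. The kept entries overwrite a random block of
    the advice, which the inverter is unlikely to read. The challenge lies in
    the chosen classes with probability [q^-(k-1)], and since collisions are
    rare any preimage found is the wanted subset. *)

Require Import Defs.
From HB Require Import structures.
From mathcomp Require Import all_boot all_order all_algebra.
From mathcomp Require Import all_classical all_reals all_analysis.
From mathcomp Require Import perm zify lra.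

Import Order.TTheory GRing.Theory Num.Theory.
Import numFieldNormedType.Exports.

Local Open Scope ring_scope.

Set Implicit Arguments.
Unset Strict Implicit.
Unset Printing Implicit Defensive.

(** * Polynomially bounded functions *)

Definition poly_bounded (f : nat -> nat) : Prop :=
  exists p : {poly nat}, forall n, (f n <= p.[n])%N.

Lemma poly_boundedC c : poly_bounded (fun=> c).
Proof. by exists c%:P => n; rewrite hornerC. Qed.

Lemma poly_bounded_id : poly_bounded id.
Proof. by exists 'X => n; rewrite hornerX. Qed.

Lemma poly_bounded_horner (p : {poly nat}) : poly_bounded (fun n => p.[n]).
Proof. by exists p. Qed.

Lemma poly_boundedD f g :
  poly_bounded f -> poly_bounded g -> poly_bounded (fun n => f n + g n)%N.
Proof.
by move=> [p fp] [q gq]; exists (p + q) => n; rewrite hornerD leq_add.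
Qed.

Lemma poly_boundedM f g :
  poly_bounded f -> poly_bounded g -> poly_bounded (fun n => f n * g n)%N.
Proof.
by move=> [p fp] [q gq]; exists (p * q) => n; rewrite hornerM leq_mul.
Qed.

Lemma poly_boundedS f : poly_bounded f -> poly_bounded (fun n => (f n).+1).
Proof.
move=> [p fp]; exists (1 + p) => n; rewrite hornerD hornerC.
by rewrite -[X in (X <= _)%N]add1n leq_add2l.
Qed.

Lemma poly_boundedX f d : poly_bounded f -> poly_bounded (fun n => f n ^ d)%N.
Proof.
move=> fb; elim: d => [|d IHd]; first exact: poly_boundedC.
have [p hp] := poly_boundedM fb IHd.
by exists p => n; rewrite expnS.
Qed.

(** * A time-bounded big-step view of oracle programs *)

Section Programs.

Local Open Scope nat_scope.

Implicit Types (O : oracles) (c : cmd) (s f : store) (w : bitseq).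

(** Big-step execution with cost bound [b]. One step count has to serve every continuation [K]; this
    is what makes executions composable. *)
Definition exec O c s w s' w' (b : nat) : Prop :=
  exists2 t, t <= b & forall K,
    iter t (step O) (State (c :: K) s w) = State K s' w'.

Lemma exec_leq O c s w s' w' b b' :
  b <= b' -> exec O c s w s' w' b -> exec O c s w s' w' b'.
Proof. by move=> le_bb' [t le_tb E]; exists t => //; apply: leq_trans le_bb'. Qed.

Lemma exec_push O r b s w : exec O (Push r b) s w (upd s r (b :: s r)) w 1.
Proof. by exists 1. Qed.

Lemma exec_pop O r s w : exec O (Pop r) s w (upd s r (behead (s r))) w 1.
Proof. by exists 1. Qed.

Lemma exec_ask O o q a s w : exec O (Ask o q a) s w (upd s a (O o (s q))) w 1.
Proof. by exists 1. Qed.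

Lemma exec_seq O c1 c2 s w s1 w1 s2 w2 b1 b2 :
  exec O c1 s w s1 w1 b1 -> exec O c2 s1 w1 s2 w2 b2 ->
  exec O (Seq c1 c2) s w s2 w2 (b1 + b2).+1.
Proof.
move=> [t1 le1 E1] [t2 le2 E2]; exists (t2 + t1).+1.
  by rewrite ltnS addnC leq_add.
by move=> K; rewrite iterSr iterD /= E1 E2.
Qed.

Lemma exec_case O r c c0 c1 s w s' w' b :
  exec O (match s r with [::] => c | b :: _ => if b then c1 else c0 end)
    s w s' w' b ->
  exec O (Case r c c0 c1) s w s' w' b.+1.
Proof. by move=> [t le_tb E]; exists t.+1 => // K; rewrite iterSr /= E. Qed.

Lemma exec_while_nil O r c s w : s r = [::] -> exec O (While r c) s w s w 1.
Proof. by move=> s0; exists 1 => // K /=; rewrite s0. Qed.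

Lemma exec_while_cons O r c s w s1 w1 s2 w2 b1 b2 : s r <> [::] ->
  exec O c s w s1 w1 b1 -> exec O (While r c) s1 w1 s2 w2 b2 ->
  exec O (While r c) s w s2 w2 (b1 + b2).+1.
Proof.
move=> s0 [t1 le1 E1] [t2 le2 E2]; exists (t2 + t1).+1.
  by rewrite ltnS addnC leq_add.
move=> K; rewrite iterSr iterD.
have -> : step O (State (While r c :: K) s w) = State [:: c, While r c & K] s w.
  by rewrite /=; case: (s r) s0.
by rewrite E1 E2.
Qed.

Lemma upd_eq s r v : upd s r v r = v.
Proof. by rewrite /upd eqxx. Qed.

Lemma upd_neq s r r' v : r' != r -> upd s r v r' = s r'.
Proof. by rewrite /upd => /negbTE ->. Qed.

Lemma upd_upd s r v v' : upd (upd s r v) r v' = upd s r v'.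
Proof. by apply/funext => i; rewrite /upd; case: eqP. Qed.

Lemma upd_id s r : upd s r (s r) = s.
Proof. by apply/funext => i; rewrite /upd; case: eqP => // ->. Qed.

Definition clear_reg r : cmd := While r (Pop r).

Lemma exec_clear O r s w :
  exec O (clear_reg r) s w (upd s r [::]) w (2 * size (s r) + 1).
Proof.
move E: (s r) => v; elim: v s E => [|b v IHv] s E.
  by rewrite -{1}E upd_id; apply: exec_while_nil.
apply: (@exec_leq _ _ _ _ _ _ (1 + (2 * size v + 1)).+1); first by move=> /=; lia.
apply: exec_while_cons; [by rewrite E | exact: exec_pop |].
by rewrite -(upd_upd s r (behead (s r)) [::]); apply: IHv; rewrite upd_eq E.
Qed.

Definition move_bit r r' : cmd :=
  Case r (Pop r) (Seq (Pop r) (Push r' false)) (Seq (Pop r) (Push r' true)).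

Lemma exec_move_bit O r r' b v s w : r != r' -> s r = b :: v ->
  exec O (move_bit r r') s w (upd (upd s r v) r' (b :: s r')) w 4.
Proof.
move=> ne E; apply: exec_case; rewrite E.
have -> : v = behead (s r) by rewrite E.
have -> : s r' = upd s r (behead (s r)) r' by rewrite upd_neq // eq_sym.
by case: b E => _; apply: (@exec_seq _ _ _ _ _ _ _ _ _ 1 1);
  (exact: exec_pop || exact: exec_push).
Qed.

Definition move_reg r r' : cmd := While r (move_bit r r').

(** Moving a stack reverses it, hence [catrev]. The programs below therefore move contents twice,
    except for unary numbers, which are their own reversal. *)
Lemma exec_move O r r' s w : r != r' ->
  exec O (move_reg r r') s w (upd (upd s r [::]) r' (catrev (s r) (s r'))) w
    (5 * size (s r) + 1).
Proof.
move=> ne; move E: (s r) => v; elim: v s E => [|b v IHv] s E /=.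
  by rewrite -{1}E !upd_id; apply: exec_while_nil.
apply: (@exec_leq _ _ _ _ _ _ (4 + (5 * size v + 1)).+1); first by lia.
apply: exec_while_cons; [by rewrite E | exact: exec_move_bit E |].
set s1 := upd _ r' _.
have -> : upd (upd s r [::]) r' (catrev v (b :: s r')) =
          upd (upd s1 r [::]) r' (catrev v (s1 r')).
  rewrite {2}/s1 upd_eq; apply/funext => i; rewrite /s1 /upd.
  by case: ifP => //; case: ifP.
by apply: IHv; rewrite /s1 upd_neq // upd_eq.
Qed.

Definition copy_bit r r1 r2 : cmd :=
  Seq (Pop r) (Seq (Push r1 true) (Push r2 true)).

(* Only meant for unary numbers. *)
Definition copy_reg r r1 r2 : cmd := While r (copy_bit r r1 r2).

Lemma exec_copy O r r1 r2 n s w : r != r1 -> r != r2 -> r1 != r2 ->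
  s r = unary n -> s r1 = [::] -> s r2 = [::] ->
  exec O (copy_reg r r1 r2) s w
    (upd (upd (upd s r [::]) r1 (unary n)) r2 (unary n)) w (6 * n + 1).
Proof.
move=> n1 n2 n12 E E1 E2.
(* Loop invariant: [a] ones have been copied and [m] remain. *)
suff H a m : a + m = n -> forall s, s r = unary m -> s r1 = unary a ->
    s r2 = unary a -> exec O (copy_reg r r1 r2) s w
    (upd (upd (upd s r [::]) r1 (unary n)) r2 (unary n)) w (6 * m + 1).
  exact: (H 0).
move=> {E E1 E2 s}; elim: m a => [|m IHm] a amn s E E1 E2.
  move: amn; rewrite addn0 => <-.
  rewrite -{1}[[::]]E upd_id -E1 upd_id E1 -E2 upd_id.
  exact: exec_while_nil.
apply: (@exec_leq _ _ _ _ _ _ (5 + (6 * m + 1)).+1); first by lia.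
pose s1 := upd (upd (upd s r (unary m)) r1 (unary a.+1)) r2 (unary a.+1).
apply: (@exec_while_cons _ _ _ _ _ s1 w); first by rewrite E.
  apply: (@exec_seq _ _ _ _ _ (upd s r (unary m)) _ _ _ 1 3).
    have -> : unary m = behead (s r) by rewrite E.
    exact: exec_pop.
  apply: (@exec_seq _ _ _ _ _ (upd (upd s r (unary m)) r1 (unary a.+1)) _ _ _ 1 1).
    rewrite [unary a.+1]/= -/(unary a) -E1 -(@upd_neq s r r1 (unary m)) 1?eq_sym //.
    exact: exec_push.
  rewrite /s1; set s2 := upd (upd s r _) r1 _.
  have -> : unary a.+1 = true :: s2 r2.
    by rewrite /s2 upd_neq 1?eq_sym // upd_neq 1?eq_sym // E2.
  exact: exec_push.
have -> : upd (upd (upd s r [::]) r1 (unary n)) r2 (unary n) =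
          upd (upd (upd s1 r [::]) r1 (unary n)) r2 (unary n).
  by apply/funext => i; rewrite /s1 /upd; do 3!case: ifP => //.
apply: (IHm a.+1); first by rewrite addSnnS.
- by rewrite /s1 (upd_neq _ _ n2) (upd_neq _ _ n1) upd_eq.
- by rewrite /s1 (upd_neq _ _ n12) upd_eq.
- by rewrite /s1 upd_eq.
Qed.

Lemma step_cat O K1 K2 s w : K1 <> [::] ->
  let st := step O (State K1 s w) in
  step O (State (K1 ++ K2) s w) = State (todo st ++ K2) (regs st) (coins st).
Proof. by case: K1 => [|[] *] //=; case: (s _). Qed.

Lemma iter_halted O st t : halted st -> iter t (step O) st = st.
Proof.
by move=> /nilP st0; elim: t => //= t ->; case: st st0 => K s w /= ->.
Qed.

(** A halting run of [K1] can be replayed in front of any [K2]. The count [t'] stops when [K1] is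
    used up: the idle steps of a halted machine would already execute [K2]. *)
Lemma run_cat O K1 s w t : let st := iter t (step O) (State K1 s w) in
  halted st ->
  exists2 t', t' <= t & forall K2,
    iter t' (step O) (State (K1 ++ K2) s w) = State K2 (regs st) (coins st).
Proof.
elim: t K1 s w => [|t IHt] K1 s w /= => [/nilP /= ->|]; first by exists 0.
case: (eqVneq (size K1) 0) => [/eqP /nilP ->|K1n].
  by rewrite -iterS iter_halted //; exists 0.
have K1n' : K1 <> [::] by move=> K10; rewrite K10 in K1n.
rewrite -iterS iterSr.
case E: (step O (State K1 s w)) => [K s1 w1] /IHt [t' le_t't Et'].
exists t'.+1 => // K2; rewrite iterSr step_cat // E /=; exact: Et'.
Qed.

(** * The program for f *)

(** Six explicit registers for the summation program, followed by the whole store [f] of the adder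
    that it calls. *)
Definition store6 (a0 a1 a2 a3 a4 a5 : bitseq) f : store := fun r =>
  match r with
  | 0 => a0 | 1 => a1 | 2 => a2 | 3 => a3 | 4 => a4 | 5 => a5
  | r'.+4.+2 => f r'
  end.

Definition empty_store : store := fun=> [::].

(* Registers are shifted by 6; oracle calls, answered by the empty string
   without oracles, are redirected to oracle 2, which returns it as well. *)
Fixpoint shift6 c : cmd :=
  match c with
  | Push r b => Push r.+4.+2 b
  | Pop r => Pop r.+4.+2
  | Flip r => Flip r.+4.+2
  | Ask _ q a => Ask 2 q.+4.+2 a.+4.+2
  | Seq c1 c2 => Seq (shift6 c1) (shift6 c2)
  | Case r c c0 c1 => Case r.+4.+2 (shift6 c) (shift6 c0) (shift6 c1)
  | While r c => While r.+4.+2 (shift6 c)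
  end.

Lemma upd_store6 a0 a1 a2 a3 a4 a5 f r v :
  upd (store6 a0 a1 a2 a3 a4 a5 f) r.+4.+2 v =
  store6 a0 a1 a2 a3 a4 a5 (upd f r v).
Proof. by apply/funext; case=> [|[|[|[|[|[|i]]]]]] //. Qed.

Lemma step_shift6 O a0 a1 a2 a3 a4 a5 K f w : (forall q, O 2 q = [::]) ->
  let st := step no_oracle (State K f w) in
  step O (State (map shift6 K) (store6 a0 a1 a2 a3 a4 a5 f) w) =
  State (map shift6 (todo st)) (store6 a0 a1 a2 a3 a4 a5 (regs st)) (coins st).
Proof.
move=> O2; case: K => [|[] *] //=; rewrite ?upd_store6 ?O2 //.
  by case: (f _) => // - [].
by case: (f _).
Qed.

Lemma iter_shift6 O a0 a1 a2 a3 a4 a5 K f w t : (forall q, O 2 q = [::]) ->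
  let st := iter t (step no_oracle) (State K f w) in
  iter t (step O) (State (map shift6 K) (store6 a0 a1 a2 a3 a4 a5 f) w) =
  State (map shift6 (todo st)) (store6 a0 a1 a2 a3 a4 a5 (regs st)) (coins st).
Proof.
move=> O2; elim: t => [//|t /= ->].
by case: (iter t _ _) => K1 f1 w1; rewrite step_shift6.
Qed.

(** Registers from this bound on are never written, so only finitely many have to be cleared after a
    run of the adder. *)
Fixpoint reg_bound c : nat :=
  match c with
  | Push r _ | Pop r | Flip r => r.+1
  | Ask _ q a => maxn q.+1 a.+1
  | Seq c1 c2 => maxn (reg_bound c1) (reg_bound c2)
  | Case r c c0 c1 =>
      maxn r.+1 (maxn (reg_bound c) (maxn (reg_bound c0) (reg_bound c1)))
  | While r c => maxn r.+1 (reg_bound c)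
  end.

Lemma step_reg_bound O m K f w : all (fun c => reg_bound c <= m) K ->
  let st := step O (State K f w) in
  all (fun c => reg_bound c <= m) (todo st) /\
  forall r, m <= r -> regs st r = f r.
Proof.
have updm (g : store) r i v : r < m -> m <= i -> upd g r v i = g i.
  by move=> rm mi; rewrite upd_neq // gtn_eqF // (leq_trans rm).
case: K => [|c K] //= /andP[cm Km]; case: c cm => /=.
- by move=> r b rm; split => // i; apply: updm.
- by move=> r rm; split => // i; apply: updm.
- by move=> r rm; split => // i; apply: updm.
- by move=> o q a; rewrite geq_max => /andP[_ am]; split => // i; apply: updm.
- by move=> c1 c2; rewrite geq_max => /andP[-> ->].
- move=> r c c0 c1; rewrite !geq_max => /and4P[_ h h0 h1]; split=> //.
  by case: (f r) => [|[] _]; rewrite ?h ?h0 ?h1.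
- move=> r c h; split=> //; case: (f r) => [|x l] //=.
  by rewrite h (leq_trans _ h) ?leq_maxr.
Qed.

Lemma iter_reg_bound O m K f w t : all (fun c => reg_bound c <= m) K ->
  forall r, m <= r -> regs (iter t (step O) (State K f w)) r = f r.
Proof.
move=> Km r mr.
suff [] : all (fun c => reg_bound c <= m) (todo (iter t (step O) (State K f w)))
  /\ regs (iter t (step O) (State K f w)) r = f r by [].
elim: t => [//|t /=]; case: (iter t _ _) => K1 f1 w1 [/= K1m <-].
by have [-> ->] := @step_reg_bound O m K1 f1 w1 K1m.
Qed.

(** A step lengthens a register by at most one bit; oracle calls are no exception, since [no_oracle]
    answers with the empty string. This bounds the cost of clearing. *)
Lemma iter_reg_size K f w t r :
  size (regs (iter t (step no_oracle) (State K f w)) r) <= size (f r) + t.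
Proof.
elim: t => [|t]; first by rewrite addn0.
rewrite addnS /=; case: (iter t _ _) => -[|c K1] f1 w1 /=; first by move/leqW.
have updm i v : size v <= (size (f1 i)).+1 -> size (f1 r) <= size (f r) + t ->
    size (upd f1 i v r) <= (size (f r) + t).+1.
  by move=> h1 h2; rewrite /upd; case: eqP => [ri|_]; [subst; lia | lia].
case: c => [i b|i|i|o q a|c1 c2|i c c0 c1|i c] /=; try exact: updm; try exact: leqW.
by apply: updm; rewrite size_behead; lia.
Qed.

(** Empties the first [m] registers of the adder. The final [clear_reg 3] stands for a skip command,
    register 3 being empty at that point. *)
Fixpoint clear_above m : cmd :=
  if m is m'.+1 then Seq (clear_reg m'.+4.+2) (clear_above m')
  else clear_reg 3.

Lemma exec_clear_above O m a0 a1 a2 a4 a5 f w B :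
  (forall r, m <= r -> f r = [::]) -> (forall r, size (f r) <= B) ->
  exec O (clear_above m) (store6 a0 a1 a2 [::] a4 a5 f) w
    (store6 a0 a1 a2 [::] a4 a5 empty_store) w (m * (2 * B + 2) + 1).
Proof.
elim: m f => [|m IHm] f f0 fB /=.
  have -> : f = empty_store by apply/funext => r; apply: f0.
  by rewrite mul0n; apply: exec_while_nil.
apply: (@exec_leq _ _ _ _ _ _ ((2 * B + 1) + (m * (2 * B + 2) + 1)).+1).
  by rewrite mulSn; lia.
apply: (@exec_seq _ _ _ _ _ (store6 a0 a1 a2 [::] a4 a5 (upd f m [::]))).
  rewrite -upd_store6.
  apply: exec_leq (exec_clear _ _ _ _); by rewrite /=; have := fB m; lia.
apply: IHm => r.
  rewrite leq_eqVlt => /orP[/eqP <-|mr]; first by rewrite upd_eq.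
  by rewrite upd_neq ?gtn_eqF // f0.
by rewrite /upd; case: eqP.
Qed.

End Programs.

Section SumProgram.

Local Open Scope nat_scope.

(* Registers: 0 holds n in unary, 1 the unread part of x, 2 the running sum,
   3 to 5 are scratch; the adder works in the registers from 6 on. *)

Definition fetch_prog (a : nat) : cmd :=
  Seq (copy_reg 0 3 4) (Seq (move_reg 3 0)
  (Seq (While 4 (Seq (Pop 4) (move_bit 1 3))) (Seq (move_reg 3 5)
  (Seq (Ask 0 5 a) (clear_reg 5))))).

(** Registers 6, 7 and 8 receive [n], the running sum and the next oracle value, which are the
    arguments of the shifted adder. Clearing afterwards lets every addition start from the same
    store; the [maxn 3] covers the three argument registers even if [M] does not mention them. *)
Definition add_prog (M : cmd) : cmd :=
  Seq (copy_reg 0 3 6) (Seq (move_reg 3 0)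
  (Seq (move_reg 2 3) (Seq (move_reg 3 7)
  (Seq (fetch_prog 8) (Seq (shift6 M)
  (Seq (move_reg 6 3) (Seq (move_reg 3 2)
    (clear_above (maxn 3 (reg_bound M)))))))))).

Fixpoint adds_prog (M : cmd) (j : nat) : cmd :=
  if j is j'.+1 then Seq (add_prog M) (adds_prog M j') else clear_reg 3.

(** The first value is fetched directly as the running sum, so no encoding of 0 is computed and [j]
    additions treat [j.+1] summands. *)
Definition sum_prog (M : cmd) (j : nat) : cmd :=
  Seq (fetch_prog 2) (Seq (adds_prog M j)
  (Seq (clear_reg 0) (Seq (move_reg 2 3) (move_reg 3 0)))).

Variable O : oracles.

Lemma exec_eq c s s1 s2 w1 w2 b :
  s1 = s2 -> exec O c s w1 s1 w2 b -> exec O c s w1 s2 w2 b.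
Proof. by move=> ->. Qed.

Lemma exec_read w n v x a0 a2 t a5 f : size v = n ->
  exec O (While 4 (Seq (Pop 4) (move_bit 1 3)))
    (store6 a0 (v ++ x) a2 t (unary n) a5 f) w
    (store6 a0 x a2 (catrev v t) [::] a5 f) w (7 * n + 1).
Proof.
move=> <-; elim: v t => [|b v IHv] t /=.
  exact: exec_while_nil.
apply: (@exec_leq _ _ _ _ _ _ (6 + (7 * size v + 1)).+1); first by lia.
apply: (@exec_while_cons _ _ _ _ _
    (store6 a0 (v ++ x) a2 (b :: t) (unary (size v)) a5 f) w) => //.
apply: (@exec_seq _ _ _ _ _ _ _ _ _ 1 4); first exact: exec_pop.
apply: exec_eq; last by apply: exec_move_bit.
by apply/funext; case=> [|[|[|[|[|[|i]]]]]] //.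
Qed.

Definition fetch_cost n := 40 * n + 20.

Lemma exec_fetch w n v x a2 f a s' : size v = n ->
  upd (store6 (unary n) x a2 [::] [::] [::] f) a (O 0 v) = s' -> a != 5 ->
  exec O (fetch_prog a) (store6 (unary n) (v ++ x) a2 [::] [::] [::] f) w
    s' w (fetch_cost n).
Proof.
move=> sv <- na.
apply: (@exec_leq _ _ _ _ _ _ ((6 * n + 1) + ((5 * n + 1) + ((7 * n + 1) +
  ((5 * n + 1) + (1 + (2 * n + 1)).+1).+1).+1).+1).+1).
  by rewrite /fetch_cost; lia.
apply: (@exec_seq _ _ _ _ _
    (store6 [::] (v ++ x) a2 (unary n) (unary n) [::] f) w).
  apply: exec_eq; last exact: exec_copy.
  by apply/funext; case=> [|[|[|[|[|[|i]]]]]] //.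
apply: (@exec_seq _ _ _ _ _
    (store6 (unary n) (v ++ x) a2 [::] (unary n) [::] f) w).
  apply: exec_eq; last first.
    by apply: exec_leq (exec_move _ _ _ _) => //=; rewrite size_nseq.
  apply/funext; case=> [|[|[|[|[|[|i]]]]]] //; rewrite /upd /=.
  by rewrite -/(rev _) rev_nseq.
apply: (@exec_seq _ _ _ _ _ (store6 (unary n) x a2 (rev v) [::] [::] f) w).
  exact: exec_read.
apply: (@exec_seq _ _ _ _ _ (store6 (unary n) x a2 [::] [::] v f) w).
  apply: exec_eq; last first.
    by apply: exec_leq (exec_move _ _ _ _) => //=; rewrite size_rev sv.
  apply/funext; case=> [|[|[|[|[|[|i]]]]]] //; rewrite /upd /=.
  by rewrite -/(rev _) revK.
apply: exec_seq; first exact: exec_ask.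
apply: exec_eq; last first.
  by apply: exec_leq (exec_clear _ _ _ _); rewrite upd_neq 1?eq_sym //= sv.
apply/funext => i; rewrite /upd; case: (eqVneq i 5) => [->|i5].
  by rewrite eq_sym (negbTE na).
by case: eqP => // _; case: i i5; do 6?case=> //.
Qed.

Definition add_cost (m n tM e : nat) :=
  fetch_cost n + 11 * n + 20 * e + 11 * tM + 20 + m * (2 * (n + e + tM) + 2).

(** The adder may consume random bits, so the remaining ones are only asserted to exist. *)
Lemma exec_add M n tM e v x g h gh w1 : (forall q, O 2 q = [::]) ->
  size v = n -> O 0 v = h -> size g <= e -> size h <= e -> size gh <= e ->
  let st := run no_oracle M [:: unary n; g; h] w1 tM in
  halted st -> output st = gh ->
  exists w2, exec O (add_prog M)
    (store6 (unary n) (v ++ x) g [::] [::] [::] empty_store) w1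
    (store6 (unary n) x gh [::] [::] [::] empty_store) w2
    (add_cost (maxn 3 (reg_bound M)) n tM e).
Proof.
move=> O2 sv Oh sg sh sgh st halt_st out_st; exists (coins st).
set m := maxn 3 _.
apply: (@exec_leq _ _ _ _ _ _ ((6 * n + 1) + ((5 * n + 1) + ((5 * e + 1) +
  ((5 * e + 1) + (fetch_cost n + (tM + ((5 * e + 1) + ((5 * e + 1) +
  (m * (2 * (n + e + tM) + 2) + 1)).+1).+1).+1).+1).+1).+1).+1).+1).
  by rewrite /add_cost; lia.
pose f1 : store := nth [::] [:: unary n].
apply: (@exec_seq _ _ _ _ _
    (store6 [::] (v ++ x) g (unary n) [::] [::] f1) w1).
  apply: exec_eq; last exact: exec_copy.
  by apply/funext; case=> [|[|[|[|[|[|[|[|[|i]]]]]]]]] //;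
    rewrite ?/upd /= ?nth_nil.
apply: (@exec_seq _ _ _ _ _
    (store6 (unary n) (v ++ x) g [::] [::] [::] f1) w1).
  apply: exec_eq; last first.
    by apply: exec_leq (exec_move _ _ _ _) => //=; rewrite size_nseq.
  apply/funext; case=> [|[|[|[|[|[|i]]]]]] //; rewrite /upd /=.
  by rewrite -/(rev _) rev_nseq.
apply: (@exec_seq _ _ _ _ _
    (store6 (unary n) (v ++ x) [::] (rev g) [::] [::] f1) w1).
  apply: exec_eq; last first.
    by apply: exec_leq (exec_move _ _ _ _) => //=; lia.
  by apply/funext; case=> [|[|[|[|[|[|i]]]]]] //.
pose f2 : store := nth [::] [:: unary n; g].
apply: (@exec_seq _ _ _ _ _
    (store6 (unary n) (v ++ x) [::] [::] [::] [::] f2) w1).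
  apply: exec_eq; last first.
    by apply: exec_leq (exec_move _ _ _ _) => //=; rewrite size_rev; lia.
  apply/funext; case=> [|[|[|[|[|[|[|[|[|i]]]]]]]]] //;
    rewrite ?/upd ?/f2 /= ?nth_nil // -?/(rev _) ?revK //.
pose f3 : store := nth [::] [:: unary n; g; h].
apply: (@exec_seq _ _ _ _ _ (store6 (unary n) x [::] [::] [::] [::] f3) w1).
  apply: exec_fetch => //; rewrite Oh.
  by apply/funext; case=> [|[|[|[|[|[|[|[|[|i]]]]]]]]] //;
    rewrite ?/upd ?/f2 ?/f3 /= ?nth_nil.
apply: (@exec_seq _ _ _ _ _
    (store6 (unary n) x [::] [::] [::] [::] (regs st)) (coins st)).
  have := @iter_shift6 O (unary n) x [::] [::] [::] [::] [:: M] f3 w1 tM O2.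
  rewrite -/(run _ _ _ _ _) -/st /=; move/nilP: (halt_st) => -> /= E.
  have := @run_cat O [:: shift6 M] (store6 (unary n) x [::] [::] [::] [::] f3)
    w1 tM.
  by rewrite E => /(_ isT).
have st_size r : size (regs st r) <= n + e + tM.
  apply: leq_trans (iter_reg_size _ _ _ _ _) _; rewrite leq_add2r.
  by case: r => [|[|[|r]]] /=; rewrite ?size_nseq ?nth_nil //=; lia.
have st_nil r : m <= r -> regs st r = [::].
  move=> mr; rewrite /st /run (@iter_reg_bound _ m) //=.
    by rewrite nth_default // (leq_trans _ mr) // leq_maxl.
  by rewrite leq_maxr.
pose f4 := upd (regs st) 0 [::].
apply: (@exec_seq _ _ _ _ _
    (store6 (unary n) x [::] (rev gh) [::] [::] f4) (coins st)).
  apply: exec_eq; last first.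
    apply: exec_leq (exec_move _ _ _ _) => //.
    by rewrite [store6 _ _ _ _ _ _ _ _]/= -/(output st) out_st; lia.
  apply/funext; case=> [|[|[|[|[|[|i]]]]]] //;
    rewrite /upd /= -/(output st) ?out_st //.
apply: (@exec_seq _ _ _ _ _
    (store6 (unary n) x gh [::] [::] [::] f4) (coins st)).
  apply: exec_eq; last first.
    by apply: exec_leq (exec_move _ _ _ _) => //=; rewrite size_rev; lia.
  by apply/funext; case=> [|[|[|[|[|[|i]]]]]] //; rewrite /upd /= -/(rev _) revK.
apply: exec_clear_above => r; first by move=> mr; rewrite /f4 /upd st_nil // if_same.
by rewrite /f4 /upd; case: ifP.
Qed.

End SumProgram.

(** * Binary encodings of indices and inputs *)

Lemma size_bits n i : size (bits n i) = n.
Proof. exact: size_mkseq. Qed.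

Lemma bitsK n i : (i < 2 ^ n)%N -> nat_of_bits (bits n i) = i.
Proof.
elim: n i => [|n IHn] i; first by rewrite expn0; case: i.
move=> lt_i.
have -> : bits n.+1 i = odd i :: bits n (i %/ 2)%N.
  rewrite /bits /mkseq -[n.+1]add1n iotaD /= expn0 divn1; congr (_ :: _).
  rewrite (iotaDl 1 0) -map_comp; apply: eq_map => j /=.
  by rewrite add1n expnS divnMA.
rewrite /= IHn; first by rewrite divn2 mul2n odd_double_half.
by rewrite ltn_divLR // mulnC -expnS.
Qed.

Lemma bits_inj n (i j : 'I_(2 ^ n)) : bits n i = bits n j -> i = j.
Proof. by move=> E; apply/val_inj; rewrite /= -(bitsK (ltn_ord i)) E bitsK. Qed.

Lemma bits_tuple_inj k n (x y : (k.-1).-tuple 'I_(2 ^ n)) :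
  bits_tuple x = bits_tuple y -> x = y.
Proof.
move=> E; apply/val_inj; move: E; rewrite /bits_tuple /=.
have : size x = size y by rewrite !size_tuple.
elim: (val x) (val y) => [|i s IHs] [|j s'] //= [] sz /eqP.
rewrite eqseq_cat ?size_bits // => /andP[/eqP /bits_inj -> /eqP E].
by rewrite (IHs _ sz E).
Qed.

(** * The function f is efficiently computable *)

Section Efficiency.

Variables (k : nat) (G : nat -> finZmodType) (enc : forall N, G N -> bitseq).

Lemma rom_oracle0 n (Ro : {ffun 'I_(2 ^ n) -> G (2 ^ n)%N}) D (i : 'I_(2 ^ n)) :
  rom_oracles enc Ro D 0 (bits n i) = enc (Ro i).
Proof.
rewrite /rom_oracles; case: pickP => [j /eqP /bits_inj -> //|].
by move=> /(_ i); rewrite eqxx.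
Qed.

Lemma exec_adds n (Ro : {ffun 'I_(2 ^ n) -> G (2 ^ n)%N}) D M tM e xs g w :
  (forall h : G (2 ^ n)%N, (size (enc h) <= e)%N) ->
  (forall (h h' : G (2 ^ n)%N) w,
    let st := run no_oracle M [:: unary n; enc h; enc h'] w tM in
    halted st /\ output st = enc (h + h')) ->
  exists w', exec (rom_oracles enc Ro D) (adds_prog M (size xs))
    (store6 (unary n) (flatten [seq bits n (i : 'I_(2 ^ n)) | i <- xs])
       (enc g) [::] [::] [::] empty_store) w
    (store6 (unary n) [::] (enc (g + \sum_(i <- xs) Ro i))
       [::] [::] [::] empty_store) w'
    (size xs * (add_cost (maxn 3 (reg_bound M)) n tM e).+1 + 1).
Proof.
move=> size_enc M_adds; elim: xs g w => [|i xs IHxs] g w.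
  by rewrite big_nil addr0; exists w; apply: exec_while_nil.
have [halt_st out_st] := M_adds g (Ro i) w.
have [w1 E1] := @exec_add (rom_oracles enc Ro D) M n tM e (bits n i)
  (flatten [seq bits n (i : 'I_(2 ^ n)) | i <- xs])
  _ _ _ w (fun=> erefl) (size_bits n i) (rom_oracle0 _ _ _)
  (size_enc _) (size_enc _) (size_enc _) halt_st out_st.
have [w2 E2] := IHxs (g + Ro i) w1.
exists w2; rewrite big_cons addrA.
by apply: exec_leq (exec_seq E1 E2); rewrite /= mulSn; lia.
Qed.

Lemma exec_run O c s w s' w' b t :
  exec O c s w s' w' b -> (b <= t)%N ->
  iter t (step O) (State [:: c] s w) = State [::] s' w'.
Proof.
move=> [t' le_t' E] le_b.
by rewrite -(subnK (leq_trans le_t' le_b)) iterD E iter_halted.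
Qed.

Lemma efficient_ksum_f : (3 <= k)%N -> efficient_groups enc ->
  ksum_f_efficient k enc.
Proof.
move=> k3 [_ [pe size_enc] [M [pM M_adds]]].
pose j := k.-2.
pose cost n := (fetch_cost n + ((j *
  (add_cost (maxn 3 (reg_bound M)) n pM.[n] pe.[n]).+1 + 1) +
  ((2 * n + 1) + ((5 * pe.[n] + 1) + (5 * pe.[n] + 1)).+1).+1).+1).+1%N.
have [p costp] : poly_bounded cost.
  rewrite /cost /add_cost /fetch_cost; repeat match goal with
  | |- poly_bounded (fun n => (_ + _)%N) => apply: poly_boundedD
  | |- poly_bounded (fun n => (_ * _)%N) => apply: poly_boundedM
  | |- poly_bounded (muln ?c) =>
      exact: (poly_boundedM (poly_boundedC c) poly_bounded_id)
  | |- poly_bounded (horner ?p) => exact: (poly_bounded_horner p)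
  | |- poly_bounded (fun n => S _) => apply: poly_boundedS
  | |- poly_bounded (fun n => _.[n]) => apply: poly_bounded_horner
  | |- poly_bounded (fun n => n) => apply: poly_bounded_id
  | |- poly_bounded (fun n => ?c) => apply: (poly_boundedC c)
  end.
exists (sum_prog M j), p => n Ro x w.
have sx : size x = j.+1 by rewrite size_tuple /j; case: k k3 => [|[|]].
rewrite /bits_tuple /ksum_f.
have -> : \sum_(i < k.-1) Ro (tnth x i) = \sum_(i <- x) Ro i by rewrite big_tuple.
case: (val x) sx => [//|i xs] [sx] /=; rewrite big_cons.
have [w1 E1] := exec_adds Ro [::] xs (Ro i) w (@size_enc n) (@M_adds n).
set u := unary n in E1 *; set g := _ + _ in E1 *.
suff E : exec (rom_oracles enc Ro [::]) (sum_prog M j)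
    (store6 u (bits n i ++ flatten [seq bits n i | i : 'I_(2 ^ n) <- xs])
      [::] [::] [::] [::] empty_store) w
    (store6 (enc g) [::] [::] [::] [::] [::] empty_store) w1 (cost n).
  have := exec_run E (costp n); rewrite /run.
  set s := store6 _ _ _ _ _ _ _ => E'.
  have -> : nth [::] [:: u; bits n i ++ flatten [seq bits n i | i : 'I_(2 ^ n) <- xs]]
    = s by apply/funext; case=> [|[|[|[|[|[|r]]]]]] //=; rewrite nth_nil.
  by rewrite E'.
rewrite sx in E1.
apply: (@exec_seq _ _ _ _ _ (store6 u
    (flatten [seq bits n i | i : 'I_(2 ^ n) <- xs])
    (enc (Ro i)) [::] [::] [::] empty_store) w).
  apply: exec_fetch => //; first exact: size_bits.
  rewrite rom_oracle0.
  by apply/funext; case=> [|[|[|[|[|[|r]]]]]].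
apply: exec_seq; first exact: E1.
apply: (@exec_seq _ _ _ _ _
    (store6 [::] [::] (enc g) [::] [::] [::] empty_store) w1).
  apply: exec_eq; last first.
    by apply: exec_leq (exec_clear _ _ _ _) => //=; rewrite size_nseq.
  by apply/funext; case=> [|[|[|[|[|[|r]]]]]].
apply: (@exec_seq _ _ _ _ _
    (store6 [::] [::] [::] (rev (enc g)) [::] [::] empty_store) w1).
  apply: exec_eq; last first.
    apply: exec_leq (exec_move _ _ _ _) => //.
    by rewrite leq_add2r leq_mul2l size_enc orbT.
  by apply/funext; case=> [|[|[|[|[|[|r]]]]]].
apply: exec_eq; last first.
  apply: exec_leq (exec_move _ _ _ _) => //.
  by rewrite leq_add2r leq_mul2l /= size_rev size_enc.
apply/funext; case=> [|[|[|[|[|[|r]]]]]] //.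
by rewrite /upd /= -/(rev _) revK.
Qed.

End Efficiency.

(** * Query traces and decision trees *)

Section Traces.

Local Open Scope nat_scope.

Implicit Types (O : oracles) (st : state).

Definition query st : seq (nat * bitseq) :=
  if todo st is Ask o q _ :: _ then [:: (o, regs st q)] else [::].

Fixpoint trace O st t : seq (nat * bitseq) :=
  if t is t'.+1 then query st ++ trace O (step O st) t' else [::].

Lemma size_trace O st t : size (trace O st t) <= t.
Proof.
elim: t st => //= t IHt st; rewrite size_cat -add1n leq_add //.
by case: st => -[|[] *].
Qed.

Lemma step_agree O O' st :
  {in query st, forall oq, O oq.1 oq.2 = O' oq.1 oq.2} -> step O st = step O' st.
Proof.
case: st => -[|c K] s w //; case: c => //= o q a agr.
by rewrite (agr (o, s q)) // mem_head.
Qed.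

(** Each query is determined by the answers to earlier ones, so agreement along the trace of one run
    forces the other run to be identical. *)
Lemma iter_agree O O' st t :
  {in trace O st t, forall oq, O oq.1 oq.2 = O' oq.1 oq.2} ->
  iter t (step O) st = iter t (step O') st /\ trace O st t = trace O' st t.
Proof.
elim: t st => // t IHt st agr.
have E : step O st = step O' st.
  by apply: step_agree => oq h; apply: agr; rewrite /= mem_cat h.
have [|E1 E2] := IHt (step O st).
  by move=> oq h; apply: agr; rewrite /= mem_cat h orbT.
by rewrite !iterSr /= -E E1 E2 E.
Qed.

Fixpoint dbind (A B : Type) (t : dtree A) (f : A -> dtree B) : dtree B :=
  match t with
  | Answer a => f a
  | Probe j g => Probe j (fun b => dbind (g b) f)
  end.

Lemma eval_dbind A B D (t : dtree A) (f : A -> dtree B) :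
  eval_dtree D (dbind t f) = eval_dtree D (f (eval_dtree D t)).
Proof. by elim: t => //= j g IHg. Qed.

Lemma depth_dbind A B (t : dtree A) (f : A -> dtree B) d :
  (forall a, depth (f a) <= d) -> depth (dbind t f) <= depth t + d.
Proof.
move=> fd; elim: t => [a|j g IHg] //=.
rewrite addSn ltnS geq_max; apply/andP; split;
  apply: leq_trans (IHg _) _; rewrite leq_add2r ?leq_maxl ?leq_maxr //.
Qed.

Fixpoint dread (js : seq nat) : dtree bitseq :=
  if js is j :: js' then
    Probe j (fun b => dbind (dread js') (fun v => Answer (b :: v)))
  else Answer [::].

Lemma eval_dread D js : eval_dtree D (dread js) = [seq nth false D j | j <- js].
Proof. by elim: js => //= j js IHjs; rewrite eval_dbind /= IHjs. Qed.

Lemma depth_dread js : depth (dread js) <= size js.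
Proof.
elim: js => //= j js IHjs; rewrite ltnS geq_max; apply/andP; split;
  by apply: leq_trans (depth_dbind _ (d := 0) _) _; rewrite ?addn0.
Qed.

(** Oracle calls become trees that compute the answer from the data structure; the other steps do
    not consult the oracle, so [no_oracle] may stand in for it. *)
Fixpoint dsim (orac : nat -> bitseq -> dtree bitseq) t st : dtree state :=
  if t is t'.+1 then
    match todo st with
    | Ask o q a :: K =>
        dbind (orac o (regs st q)) (fun v =>
          dsim orac t' (State K (upd (regs st) a v) (coins st)))
    | _ => dsim orac t' (step no_oracle st)
    end
  else Answer st.

Lemma eval_dsim D orac t st : eval_dtree D (dsim orac t st) =
  iter t (step (fun o q => eval_dtree D (orac o q))) st.
Proof.
elim: t st => // t IHt st; rewrite iterSr /=.
by case: st => -[|c K] s w; last case: c => *; rewrite /= ?eval_dbind IHt.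
Qed.

Lemma depth_dsim orac t st l : (forall o q, depth (orac o q) <= l) ->
  depth (dsim orac t st) <= t * l.
Proof.
move=> hl; elim: t st => // t IHt st; rewrite mulSn /=.
case: st => -[|c K] s w; last case: c => *;
  rewrite /= ?(leq_trans (IHt _)) ?leq_addl //.
by apply: leq_trans (depth_dbind _ (fun=> IHt _)) _; rewrite leq_add2r.
Qed.

End Traces.

(** * Averages *)

Section Averages.

Variable R : realType.

Lemma eq_avg (T : finType) (A : {set T}) (F F' : T -> R) :
  {in A, F =1 F'} -> avg A F = avg A F'.
Proof. by move=> E; rewrite /avg (eq_bigr _ E). Qed.

Lemma ler_avg (T : finType) (A : {set T}) (F F' : T -> R) :
  (forall x, x \in A -> F x <= F' x) -> avg A F <= avg A F'.
Proof. by move=> le_FF'; rewrite ler_wpM2r ?invr_ge0 ?ler_sum. Qed.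

Lemma avg_ge0 (T : finType) (A : {set T}) (F : T -> R) :
  (forall x, x \in A -> 0 <= F x) -> 0 <= avg A F.
Proof. by move=> F0; rewrite mulr_ge0 ?invr_ge0 ?sumr_ge0. Qed.

Lemma avgD (T : finType) (A : {set T}) (F F' : T -> R) :
  avg A (fun x => F x + F' x) = avg A F + avg A F'.
Proof. by rewrite /avg big_split mulrDl. Qed.

Lemma avgZ (T : finType) (A : {set T}) c (F : T -> R) :
  avg A (fun x => c * F x) = c * avg A F.
Proof. by rewrite /avg -mulr_sumr mulrA. Qed.

Lemma avgB (T : finType) (A : {set T}) (F F' : T -> R) :
  avg A (fun x => F x - F' x) = avg A F - avg A F'.
Proof. by rewrite /avg sumrB mulrBl. Qed.

Lemma avg_sum (T I : finType) (A : {set T}) (P : pred I) (F : I -> T -> R) :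
  avg A (fun x => \sum_(i | P i) F i x) = \sum_(i | P i) avg A (F i).
Proof. by rewrite /avg exchange_big mulr_suml. Qed.

Lemma avgC (T U : finType) (A : {set T}) (B : {set U}) (F : T -> U -> R) :
  avg A (fun x => avg B (F x)) = avg B (fun y => avg A (F ^~ y)).
Proof.
rewrite /avg -!mulr_suml exchange_big -!mulrA; congr (_ * _).
by rewrite mulrC.
Qed.

Lemma avg_cst (T : finType) (A : {set T}) (c : R) :
  (0 < #|A|)%N -> avg A (fun=> c) = c.
Proof.
by move=> A0; rewrite /avg sumr_const -[c *+ _]mulr_natr mulfK // pnatr_eq0 -lt0n.
Qed.

(** The condition [0 <= c] covers the empty set, whose average is 0. *)
Lemma avg_le_cst (T : finType) (A : {set T}) (F : T -> R) c :
  0 <= c -> (forall x, x \in A -> F x <= c) -> avg A F <= c.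
Proof.
move=> c0 Fc; apply: le_trans (ler_avg Fc) _.
case: (posnP #|A|) => [A0|A0]; last by rewrite avg_cst.
by rewrite /avg A0 invr0 mulr0.
Qed.

Lemma avgT_inv (T : finType) (h : T -> T) (F : T -> R) :
  involutive h -> avg [set: T] (F \o h) = avg [set: T] F.
Proof.
move=> hK; rewrite /avg [in RHS](reindex_inj (inv_inj hK)) /=; congr (_ / _).
by apply: eq_bigl => x; rewrite !inE.
Qed.

Lemma avgT_pair (T U : finType) (F : T * U -> R) :
  avg [set: T * U] F =
  avg [set: T] (fun x => avg [set: U] (fun y => F (x, y))).
Proof.
rewrite /avg -mulr_suml -mulrA -invfM -natrM !cardsT card_prod mulnC.
congr (_ / _); rewrite pair_big /=.
by apply: eq_big => [[x y]|[x y] _]; rewrite ?inE.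
Qed.

Lemma avgT2_inv (T U : finType) (h : T * U -> T * U) (F : T -> U -> R) :
  involutive h ->
  avg [set: T] (fun x => avg [set: U] (fun y => F (h (x, y)).1 (h (x, y)).2)) =
  avg [set: T] (fun x => avg [set: U] (F x)).
Proof.
move=> hK; rewrite -(avgT_pair (fun p => F p.1 p.2)).
rewrite -(avgT_pair (fun p => F (h p).1 (h p).2)).
exact: (avgT_inv (fun p => F p.1 p.2) hK).
Qed.

End Averages.

(** * Reprogramming the oracle at one point of the input *)

Section Reprogram.

Variables (R : realType) (k N : nat) (G : finZmodType).

Implicit Types (a : {ffun 'I_N -> G}) (b : G) (x : (k.-1).-tuple 'I_N)
  (l : 'I_k.-1).

(** If [x] has distinct coordinates, the new entry is the unique one that gives [x] the value
    [b]. *)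
Definition reprogram x l a b : {ffun 'I_N -> G} :=
  [ffun i => if i == tnth x l
             then b - \sum_(j < k.-1 | j != l) a (tnth x j) else a i].

Lemma reprogram_neq x l a b i : i != tnth x l -> reprogram x l a b i = a i.
Proof. by rewrite ffunE => /negbTE ->. Qed.

Lemma ksum_f_reprogram_notin x l a b x' : tnth x l \notin x' ->
  ksum_f (reprogram x l a b) x' = ksum_f a x'.
Proof.
move=> x'l; apply: eq_bigr => j _; rewrite reprogram_neq //.
by apply: contraNneq x'l => <-; rewrite mem_tnth.
Qed.

Lemma reprogram_rest x l a b : uniq x ->
  \sum_(j < k.-1 | j != l) reprogram x l a b (tnth x j) =
  \sum_(j < k.-1 | j != l) a (tnth x j).
Proof.
move=> /tuple_uniqP ux; apply: eq_bigr => j jl.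
by rewrite reprogram_neq // (inj_eq ux).
Qed.

Lemma ksum_f_reprogram x l a b : uniq x -> ksum_f (reprogram x l a b) x = b.
Proof.
move=> ux; rewrite /ksum_f (bigD1 l) //= reprogram_rest // ffunE eqxx.
by rewrite subrK.
Qed.

Lemma reprogramK x l a b : uniq x ->
  reprogram x l (reprogram x l a b) (ksum_f a x) = a.
Proof.
move=> ux; apply/ffunP => i; rewrite ffunE reprogram_rest //.
case: eqP => [->|/eqP ne]; last exact: reprogram_neq.
by rewrite /ksum_f (bigD1 l) //= addrK.
Qed.

(* Exchanging b with the value of f at x is an involution on pairs (a, b). *)
Lemma avg_reprogram x l (F : {ffun 'I_N -> G} -> G -> R) : uniq x ->
  avg [set: {ffun 'I_N -> G}] (fun a => avg [set: G] (fun b =>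
    F (reprogram x l a b) (ksum_f a x))) =
  avg [set: {ffun 'I_N -> G}] (fun a => avg [set: G] (F a)).
Proof.
move=> ux.
pose h (p : {ffun 'I_N -> G} * G) := (reprogram x l p.1 p.2, ksum_f p.1 x).
apply: (@avgT2_inv R _ _ h F) => -[a b].
by rewrite /h /= reprogramK // ksum_f_reprogram.
Qed.

Lemma avg_reprogram1 x l (F : {ffun 'I_N -> G} -> R) : uniq x ->
  avg [set: {ffun 'I_N -> G}] F =
  avg [set: {ffun 'I_N -> G}] (fun a => avg [set: G] (fun b =>
    F (reprogram x l a b))).
Proof.
move=> ux; rewrite (avg_reprogram l (fun a _ => F a)) //.
apply: eq_avg => a _; rewrite avg_cst // cardsT; apply/card_gt0P; by exists 0.
Qed.

Lemma cardG_gt0 : 0 < #|G|%:R :> R.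
Proof. by rewrite ltr0n; apply/card_gt0P; exists 0. Qed.

Lemma avg_eq_cst (g : G) : avg [set: G] (fun b => (g == b)%:R : R) = #|G|%:R^-1.
Proof.
rewrite /avg (bigD1 g) ?inE //= eqxx big1 ?addr0 ?cardsT ?mul1r //.
by move=> i /andP[_]; rewrite eq_sym => /negbTE ->.
Qed.

(* Bounds the chance that a given input shares its value with an unrelated
   one. *)
Definition collision_bound : R := (N ^ k.-1)%:R / #|G|%:R.

Lemma collision_bound_ge0 : 0 <= collision_bound.
Proof. by rewrite divr_ge0. Qed.

Lemma sum_tuple_cst (c : R) :
  \sum_(x : (k.-1).-tuple 'I_N) c = (N ^ k.-1)%:R * c.
Proof. by rewrite sumr_const card_tuple card_ord mulr_natl. Qed.

Lemma exists_le_sum (T : finType) (P : pred T) :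
  [exists x, P x]%:R <= \sum_x (P x)%:R :> R.
Proof.
case: existsP => [[x Px]|_]; last by rewrite sumr_ge0.
by rewrite (bigD1 x) //= Px lerDl sumr_ge0.
Qed.

(** Union bound over the [N ^ k.-1] tuples: a uniform [b] equals a given value with probability
    [1 / #|G|]. *)
Lemma avg_image_le a :
  avg [set: G] (fun b => [exists x : (k.-1).-tuple 'I_N, ksum_f a x == b]%:R : R)
  <= collision_bound.
Proof.
apply: le_trans (ler_avg (fun b _ => exists_le_sum _)) _.
rewrite avg_sum; under eq_bigr do rewrite avg_eq_cst.
by rewrite sum_tuple_cst.
Qed.

(** Permutations of [x] trivially have the same value and are excluded. The tuple [x'] may repeat
    coordinates, since an inverter may output any tuple. *)
Definition collides a x :=
  [exists x' : (k.-1).-tuple 'I_N,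
    ~~ perm_eq x' x && (ksum_f a x' == ksum_f a x)].

(** A tuple [x'] that is not a permutation of [x] misses some point of [x]. Resampling the table
    there makes the value at [x] uniform and leaves the value at [x'] alone. *)
Lemma avg_collides x : uniq x ->
  avg [set: {ffun 'I_N -> G}] (fun a => (collides a x)%:R : R)
  <= collision_bound.
Proof.
move=> ux; apply: le_trans (ler_avg (fun a _ => exists_le_sum _)) _.
rewrite avg_sum /collision_bound -sum_tuple_cst; apply: ler_sum => x' _.
case: (boolP (perm_eq x' x)) => [_|nperm] /=.
  by rewrite avg_le_cst ?invr_ge0.
have [l xl] : exists l, tnth x l \notin x'.
  apply/existsP; apply: contraR nperm; rewrite negb_exists => /forallP sub.
  have sub' : {subset x <= x'}.
    by move=> i /tnthP[l ->]; have := sub l; rewrite negbK.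
  have [|eqs eqm] := uniq_min_size ux sub'; first by rewrite !size_tuple.
  rewrite perm_sym; apply: uniq_perm => //.
  by rewrite -(eq_uniq eqs eqm).
rewrite (avg_reprogram1 l _ ux).
apply: avg_le_cst; first by rewrite invr_ge0.
move=> a _; rewrite -(avg_eq_cst (ksum_f a x')); apply: ler_avg => b _.
by rewrite ksum_f_reprogram // ksum_f_reprogram_notin.
Qed.

(** A coordinate of a random input is uniform, because transposing two indices permutes the inputs.
    It is an inequality because there may be no inputs at all. *)
Lemma avg_tnth_le (l : 'I_k.-1) (A : {set 'I_N}) :
  avg (ksum_inputs k N) (fun x => (tnth x l \in A)%:R : R) <= #|A|%:R / N%:R.
Proof.
pose c i := \sum_(x in ksum_inputs k N) (tnth x l == i)%:R : R.
have cC i j : c i = c j.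
  pose h (x : (k.-1).-tuple 'I_N) := map_tuple (tperm i j) x.
  have hK : involutive h.
    by move=> x; apply: eq_from_tnth => y; rewrite !tnth_map tpermK.
  rewrite /c [RHS](reindex_inj (inv_inj hK)) /=; apply: eq_big => x.
    by rewrite !inE map_inj_uniq //; apply: perm_inj.
  by rewrite tnth_map -(inj_eq (@perm_inj _ (tperm i j)) _ i) tpermL.
have sum_c (B : {set 'I_N}) :
    \sum_(x in ksum_inputs k N) (tnth x l \in B)%:R = \sum_(i in B) c i.
  rewrite /c exchange_big; apply: eq_bigr => x _ /=.
  case: (boolP (tnth x l \in B)) => [xB|xB].
    by rewrite (bigD1 (tnth x l)) //= eqxx big1 ?addr0 // => i /andP[_];
      rewrite eq_sym => /negbTE ->.
  by rewrite big1 // => i iB; case: eqP => // xi; rewrite xi iB in xB.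
rewrite /avg sum_c.
case: (pickP 'I_N) => [i0 _|N0]; last first.
  rewrite big1; first by rewrite mul0r divr_ge0.
  by move=> i; have := N0 i.
have N_gt0 : 0 < N%:R :> R by rewrite ltr0n; case: N i0 {c cC sum_c A} => [[]|].
have cE : N%:R * c i0 = #|ksum_inputs k N|%:R.
  have := sum_c [set: 'I_N]; under eq_bigr do rewrite inE.
  rewrite sumr_const => ->.
  rewrite (eq_bigr (fun=> c i0)) => [|i _]; last exact: cC.
  by rewrite sumr_const cardsT card_ord mulr_natl.
rewrite (eq_bigr (fun=> c i0)) => [|i _]; last exact: cC.
rewrite sumr_const -cE -[c i0 *+ _]mulr_natl invfM.
case: (eqVneq (c i0) 0) => [->|c0]; first by rewrite mulr0 mul0r divr_ge0.
by rewrite mulrACA mulfV // mulr1.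
Qed.

End Reprogram.

(** * Short advice: an unconditional bound *)

Section ShortAdvice.

Variables (R : realType) (k N : nat) (G : finZmodType).

Local Notation table := {ffun 'I_N -> G}.
Local Notation input := ((k.-1).-tuple 'I_N).

Implicit Types (a : table) (b : G) (x : input) (l : 'I_k.-1).

(** Certificates as in query complexity: the entries of [a] in [C a] determine both the event and
    the certificate itself. *)
Definition certified (E : table -> bool) (C : table -> {set 'I_N}) : Prop :=
  forall a a', {in C a, a =1 a'} -> C a' = C a /\ E a' = E a.

(* Q a b is the set of positions read in the run on b, and includes those of
   the output. *)
Record query_solver (T : nat) (out : table -> G -> option input)
    (Q : table -> G -> {set 'I_N}) : Prop := QuerySolver {
  solver_local : forall a a' b, {in Q a b, a =1 a'} ->
    Q a' b = Q a b /\ out a' b = out a b;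
  solver_reads_output : forall a b x, out a b = Some x -> {subset x <= Q a b};
  solver_card : forall a b, (#|Q a b| <= T)%N }.

Definition solves (out : table -> G -> option input) a x : bool :=
  if out a (ksum_f a x) is Some x' then ksum_f a x' == ksum_f a x else false.

Section OneSolver.

Variables (T : nat) (out : table -> G -> option input).
Variables (Q : table -> G -> {set 'I_N}).
Hypothesis solver : query_solver T out Q.

Definition solve_cert x a : {set 'I_N} := [set i in x] :|: Q a (ksum_f a x).

(** The entries at [x] fix the challenge; those in [Q] fix the run and the value of its output. *)
Lemma certified_solves x : certified (solves out ^~ x) (solve_cert x).
Proof.
move=> a a' agr.
have fx : ksum_f a' x = ksum_f a x.
  by apply: eq_bigr => j _; rewrite -agr // !inE mem_tnth.
have [|EQ Eout] := @solver_local _ _ _ solver a a' (ksum_f a x).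
  by move=> i iQ; apply: agr; rewrite inE iQ orbT.
split; first by rewrite /solve_cert fx EQ.
rewrite /solves fx Eout; case E: (out _ _) => [x'|//].
congr (_ == _); apply: eq_bigr => j _; rewrite -agr // inE orbC.
by rewrite (solver_reads_output solver E) // mem_tnth.
Qed.

Lemma card_solve_cert x a : (#|solve_cert x a| <= T + k.-1)%N.
Proof.
rewrite (leq_trans (leq_card_setU _ _)) // addnC leq_add ?(solver_card solver) //.
by rewrite cardsE (leq_trans (card_size _)) // size_tuple.
Qed.

Lemma certifiedI E1 C1 E2 C2 : certified E1 C1 -> certified E2 C2 ->
  certified (fun a => E1 a && E2 a) (fun a => C1 a :|: C2 a).
Proof.
move=> c1 c2 a a' agr.
have [|-> ->] := c1 a a'; first by move=> i iC; apply: agr; rewrite inE iC.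
by have [|-> ->] := c2 a a'; first by move=> i iC; apply: agr; rewrite inE iC orbT.
Qed.

(** If [x0] lies outside the certificate, reprogramming the table there preserves [E] and makes the
    challenge a uniform [b] independent of [a]. A solver that does not read [x0] then behaves as on
    [a], and can only win if [b] is a value of [ksum_f a]. *)
Lemma avg_solves_at (E : table -> bool) C x l : certified E C -> uniq x ->
  avg [set: table] (fun a => (E a && solves out a x)%:R : R) <=
  avg [set: table] (fun a => (E a)%:R * (tnth x l \in C a)%:R) +
  avg [set: table] (fun a => (E a)%:R * avg [set: G] (fun b =>
    (tnth x l \in Q a b)%:R + [exists x' : input, ksum_f a x' == b]%:R)).
Proof.
move=> cE ux; set x0 := tnth x l.
have -> : avg [set: table] (fun a => (E a && solves out a x)%:R : R) =
    avg [set: table] (fun a => (E a && (x0 \in C a) && solves out a x)%:R : R) +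
    avg [set: table] (fun a => (E a && (x0 \notin C a) && solves out a x)%:R).
  rewrite -avgD; apply: eq_avg => a _.
  by case: (E a) (x0 \in C a) (solves out a x) => [] [] [];
    rewrite /= ?addr0 ?add0r.
apply: lerD.
  apply: ler_avg => a _; rewrite -natrM mulnb ler_nat.
  by case: (E a && _) (solves _ _ _) => [] [].
rewrite (avg_reprogram1 l _ ux); apply: ler_avg => a _.
rewrite -avgZ; apply: ler_avg => b _.
set a' := reprogram x l a b.
have agr i : i != x0 -> a' i = a i by exact: reprogram_neq.
case: (boolP (E a' && _ && _)) => [|_]; last first.
  by rewrite mulr_ge0 // addr_ge0.
move=> /andP[/andP[Ea' x0C] solved].
have -> : E a.
  have [|_ -> //] := cE a' a; move=> i iC; apply: agr.
  by apply: contraNneq x0C => <-.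
rewrite mul1r -natrD ler1n addn_gt0 !lt0b.
case: (boolP (x0 \in Q a b)) => //= x0Q.
move: solved; rewrite /solves ksum_f_reprogram //.
have [|_ ->] := @solver_local _ _ _ solver a a' b.
  by move=> i iQ; apply/esym/agr; apply: contraNneq x0Q => <-.
case Eo: (out a b) => [x'|//] fx'; apply/existsP; exists x'.
rewrite -(eqP fx') ksum_f_reprogram_notin //.
by apply: contra x0Q; apply: (solver_reads_output solver Eo).
Qed.

(** At most [q] entries are revealed by the conditioning event and at most [T] are read in the run;
    the last term bounds the chance that a uniform [b] has a preimage. *)
Definition solve_bound (q : nat) : R :=
  (q + T)%:R / N%:R + collision_bound R k N G.

Lemma avg_solves (E : table -> bool) C q : (0 < k.-1)%N -> certified E C ->
  (forall a, (#|C a| <= q)%N) ->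
  avg (ksum_inputs k N) (fun x =>
    avg [set: table] (fun a => (E a && solves out a x)%:R : R)) <=
  solve_bound q * avg [set: table] (fun a => (E a)%:R).
Proof.
move=> k_gt0 cE Cq; pose l := Ordinal k_gt0.
apply: le_trans (ler_avg (F' := _) _) _.
  by move=> x; rewrite inE => ux; apply: (avg_solves_at l cE ux).
have cardN (A : {set 'I_N}) m : (#|A| <= m)%N ->
    avg (ksum_inputs k N) (fun x => (tnth x l \in A)%:R : R) <= m%:R / N%:R.
  move=> Am; apply: le_trans (avg_tnth_le _ _ _) _.
  by rewrite ler_wpM2r ?invr_ge0 ?ler_nat.
have -> : solve_bound q =
    q%:R / N%:R + (T%:R / N%:R + collision_bound R k N G).
  by rewrite /solve_bound natrD mulrDl addrA.
rewrite avgD [leRHS]mulrDl; apply: lerD; rewrite avgC -avgZ; apply: ler_avg => a _.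
  by rewrite avgZ mulrC ler_wpM2r // cardN.
rewrite avgZ mulrC ler_wpM2r //.
under eq_avg do rewrite avgD.
rewrite avgD; apply: lerD.
  rewrite avgC; apply: avg_le_cst => [|b _]; first by rewrite divr_ge0.
  by rewrite cardN ?(solver_card solver).
apply: avg_le_cst => [|x _]; [exact: collision_bound_ge0 | exact: avg_image_le].
Qed.

Lemma solve_bound_ge0 q : 0 <= solve_bound q.
Proof. by rewrite addr_ge0 ?divr_ge0 ?collision_bound_ge0. Qed.

Lemma le_solve_bound q q' : (q <= q')%N -> solve_bound q <= solve_bound q'.
Proof.
by move=> qq'; rewrite lerD2r ler_wpM2r ?invr_ge0 // ler_nat leq_add2r.
Qed.

Definition solve_prob a : R :=
  avg (ksum_inputs k N) (fun x => (solves out a x)%:R).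

(** Induction on [t]: one factor [solve_prob] is expanded into a random [x], and success on [x]
    joins the event, whose certificate grows by at most [T + k.-1]. The number [m] dominates all
    certificate sizes that occur, so each round costs the same factor. *)
Lemma avg_solve_prob_certified (E : table -> bool) C q t m :
  (0 < k.-1)%N -> certified E C -> (forall a, (#|C a| <= q)%N) ->
  (q + t * (T + k.-1) <= m)%N ->
  avg [set: table] (fun a => (E a)%:R * solve_prob a ^+ t) <=
  solve_bound m ^+ t * avg [set: table] (fun a => (E a)%:R).
Proof.
move=> k_gt0; elim: t E C q => [|t IHt] E C q cE Cq qm.
  by rewrite expr0 mul1r; apply: ler_avg => a _; rewrite mulr1.
have -> : avg [set: table] (fun a => (E a)%:R * solve_prob a ^+ t.+1) =
    avg (ksum_inputs k N) (fun x => avg [set: table] (fun a =>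
      (E a && solves out a x)%:R * solve_prob a ^+ t)).
  rewrite avgC; apply: eq_avg => a _.
  rewrite exprSr [X in _ * (_ * X)]/solve_prob mulrA -avgZ; apply: eq_avg => x _.
  by rewrite -mulnb natrM mulrAC.
apply: (@le_trans _ _ (avg (ksum_inputs k N) (fun x => solve_bound m ^+ t *
    avg [set: table] (fun a => (E a && solves out a x)%:R)))).
  apply: ler_avg => x _.
  apply: (IHt (fun a => E a && solves out a x) _ (q + (T + k.-1))%N).
  - exact: (certifiedI cE (@certified_solves x)).
  - move=> a; rewrite (leq_trans (leq_card_setU _ _)) // leq_add //.
    exact: card_solve_cert.
  - by move: qm; rewrite mulSn addnA.
rewrite avgZ exprSr -mulrA ler_wpM2l ?exprn_ge0 ?solve_bound_ge0 //.
apply: le_trans (avg_solves k_gt0 cE Cq) _.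
rewrite ler_wpM2r ?avg_ge0 // le_solve_bound //.
by rewrite (leq_trans _ qm) // leq_addr.
Qed.

Lemma avg_solve_prob_exp t : (0 < k.-1)%N ->
  avg [set: table] (fun a => solve_prob a ^+ t) <=
  solve_bound (t * (T + k.-1)) ^+ t.
Proof.
move=> k_gt0.
have cT : certified (fun=> true) (fun=> finset.set0) by [].
have := @avg_solve_prob_certified _ _ 0 t _ k_gt0 cT
  (fun=> eq_leq (cards0 _)) (leqnn _).
rewrite add0n (_ : avg _ (fun=> true%:R) = 1); first rewrite mulr1.
  by apply: le_trans; apply: ler_avg => a _; rewrite mul1r.
rewrite avg_cst // cardsT; apply/card_gt0P; by exists [ffun=> 0].
Qed.

End OneSolver.

(* Union bound over the advice strings d: with probability at least
   1 - #|D| / 4^t no solver of the family succeeds with probability more than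
   four times the bound for a single solver. *)
Lemma avg_solve_prob_advice (D : finType) (T t : nat)
    (out : D -> table -> G -> option input)
    (Q : D -> table -> G -> {set 'I_N}) (adv : table -> D) :
  (0 < k.-1)%N -> (0 < N)%N ->
  (forall d, query_solver T (out d) (Q d)) ->
  avg [set: table] (fun a => solve_prob (out (adv a)) a) <=
  4 * solve_bound T (t * (T + k.-1)) + #|D|%:R / 4 ^+ t.
Proof.
move=> k_gt0 N_gt0 solver; set beta := solve_bound T _.
have beta_gt0 : 0 < beta.
  by rewrite ltr_wpDl ?divr_ge0 // divr_gt0 ?cardG_gt0 // ltr0n expn_gt0 N_gt0.
have prob_ge0 d a : 0 <= solve_prob (out d) a by rewrite avg_ge0.
have prob_le1 d a : solve_prob (out d) a <= 1.
  by apply: avg_le_cst => // x _; rewrite lern1 leq_b1.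
have term_ge0 a d : 0 <= (4 * beta) ^- t * solve_prob (out d) a ^+ t.
  rewrite mulr_ge0 ?exprn_ge0 // invr_ge0 exprn_ge0 // mulr_ge0 // ltW //.
(* Markov's inequality for the [t]-th moment, pointwise: if [y] exceeds [4 * beta], the summand of
   the advice actually given is at least 1. *)
apply: (@le_trans _ _ (avg [set: table] (fun a => 4 * beta +
    \sum_d (4 * beta) ^- t * solve_prob (out d) a ^+ t))).
  apply: ler_avg => a _; set y := solve_prob _ _.
  case: (leP y (4 * beta)) => [le_y|/ltW le_y].
    apply: (le_trans le_y); rewrite lerDl.
    by apply: sumr_ge0 => d _; apply: term_ge0.
  apply: (le_trans (prob_le1 _ _)); apply: ler_wpDl; first by rewrite mulr_ge0 ?ltW.
  rewrite (bigD1 (adv a)) //=; apply: ler_wpDr.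
    by apply: sumr_ge0 => d _; apply: term_ge0.
  rewrite mulrC -exprVn -exprMn exprn_ege1 // ler_pdivlMr ?mul1r //.
  by rewrite mulr_gt0.
rewrite avgD avg_sum; apply: lerD.
  by apply: avg_le_cst => //; rewrite mulr_ge0 // ltW.
apply: (@le_trans _ _ (\sum_(d : D) 4 ^- t)); last first.
  by rewrite sumr_const -[leLHS]mulr_natl.
apply: ler_sum => d _; rewrite avgZ exprMn invfM -mulrA.
rewrite ler_piMr ?invr_ge0 ?exprn_ge0 //.
rewrite mulrC ler_pdivrMr ?exprn_gt0 // mul1r.
exact: avg_solve_prob_exp (solver d) _ k_gt0.
Qed.

End ShortAdvice.

(** * Runs of an inverter *)

Lemma card_preim_seq (I : finType) (U : eqType) (f : I -> U) (s : seq U) :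
  injective f -> (#|[set i | f i \in s]| <= size s)%N.
Proof.
move=> f_inj; rewrite cardE -(size_map f); apply: uniq_leq_size.
  by rewrite map_inj_uniq // enum_uniq.
by move=> u /mapP[i]; rewrite mem_enum inE => fi ->.
Qed.

Section Inverter.

Variables (R : realType) (k : nat) (G : nat -> finZmodType).
Variables (enc : forall N, G N -> bitseq) (n : nat) (A2 : cmd) (T : nat).

Local Notation N := (2 ^ n)%N.
Local Notation table := {ffun 'I_N -> G N}.
Local Notation input := ((k.-1).-tuple 'I_N).

Implicit Types (Ro : table) (D v : bitseq) (b : G N) (x : input).

Definition start b r : state := State [:: A2] (nth [::] [:: unary n; enc b]) r.

Definition inv_out Ro D b r : bitseq :=
  output (iter T (step (rom_oracles enc Ro D)) (start b r)).

Definition inv_trace Ro D b r : seq (nat * bitseq) :=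
  trace (rom_oracles enc Ro D) (start b r) T.

Definition decode_input v : option input := [pick x | bits_tuple x == v].

Lemma invertsE Ro b v : inverts k Ro b v =
  if decode_input v is Some x then ksum_f Ro x == b else false.
Proof.
rewrite /inverts /decode_input; case: pickP => [x /eqP <-|no_x].
  apply/existsP/idP => [[x' /andP[/eqP /bits_tuple_inj -> //]]|fx].
  by exists x; rewrite eqxx.
by apply/existsP => -[x]; rewrite no_x.
Qed.

Definition inv_reads D r Ro b : {set 'I_N} :=
  [set i : 'I_N | (0%N, bits n i) \in inv_trace Ro D b r] :|:
  (if decode_input (inv_out Ro D b r) is Some x then [set i in x] else finset.set0).

Lemma rom_oracles_agree Ro Ro' D o q :
  (forall i : 'I_N, o = 0%N -> q = bits n i -> Ro i = Ro' i) ->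
  rom_oracles enc Ro D o q = rom_oracles enc Ro' D o q.
Proof.
case: o => [|[|o]] //= agr; case: pickP => // i /eqP qi.
by rewrite (agr i).
Qed.

Lemma inverter_query_solver D r : query_solver (T + k.-1)
  (fun Ro b => decode_input (inv_out Ro D b r)) (inv_reads D r).
Proof.
split.
- move=> Ro Ro' b agr.
  have [] := @iter_agree (rom_oracles enc Ro D) (rom_oracles enc Ro' D)
    (start b r) T.
    move=> [] o q oq /=; apply: rom_oracles_agree => i o0 qi.
    by subst o q; apply: agr; rewrite !inE /inv_trace oq.
  by rewrite /inv_reads /inv_out /inv_trace => -> ->.
- move=> Ro b x E i ix; rewrite /inv_reads E !inE; apply/orP; right.
  exact: ix.
- move=> Ro b; rewrite (leq_trans (leq_card_setU _ _)) // leq_add //.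
    apply: leq_trans (card_preim_seq _ _) (size_trace _ _ _) => i j [].
    exact: bits_inj.
  case: decode_input => [x|]; last by rewrite cards0.
  by rewrite cardsE (leq_trans (card_size _)) // size_tuple.
Qed.

Lemma eq_rom_oracles Ro D D' : nth false D =1 nth false D' ->
  rom_oracles enc Ro D = rom_oracles enc Ro D'.
Proof.
by move=> E; apply/funext => -[|[|o]]; apply/funext => q //=; rewrite E.
Qed.

Definition inv_success A1 Ro x r : bool :=
  inverts k Ro (ksum_f Ro x) (inv_out Ro (A1 Ro) (ksum_f Ro x) r).

(** With [T = p.[n]] this is convertible to [inversion_prob]. *)
Definition inv_prob (A1 : table -> bitseq) : R :=
  avg [set: table] (fun Ro => avg (ksum_inputs k N) (fun x =>
    avg [set: T.-tuple bool] (fun r => (inv_success A1 Ro x r)%:R))).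

Lemma inv_prob_short_advice (A1 : table -> bitseq) L t : (0 < k.-1)%N ->
  (forall Ro, (size (A1 Ro) <= L)%N) ->
  inv_prob A1 <= 4 * solve_bound R k N (G N) (T + k.-1)
    (t * (T + k.-1 + k.-1)) + (2 ^ L)%:R / 4 ^+ t.
Proof.
move=> k_gt0 size_A1.
(* Padding to exactly [L] bits puts the advice into a type with [2 ^ L] elements. The padding is
   invisible, as oracle 1 answers [false] beyond the end. *)
pose adv Ro : L.-tuple bool := [tuple nth false (A1 Ro) j | j < L].
have advE Ro : rom_oracles enc Ro (A1 Ro) = rom_oracles enc Ro (adv Ro).
  apply: eq_rom_oracles => j; case: (ltnP j L) => [jL|Lj]; last first.
    by rewrite !nth_default // ?size_tuple // (leq_trans (size_A1 _)).
  by rewrite -[j]/(val (Ordinal jL)) -tnth_nth tnth_mktuple.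
have -> : inv_prob A1 = avg [set: T.-tuple bool] (fun r =>
    avg [set: table] (fun Ro => solve_prob R
      (fun Ro' b => decode_input (inv_out Ro' (adv Ro) b r)) Ro)).
  rewrite avgC; apply: eq_avg => Ro _; rewrite -avgC; apply: eq_avg => x _.
  apply: eq_avg => r _; rewrite /inv_success invertsE /solves.
  by rewrite /inv_out advE.
apply: avg_le_cst => [|r _].
  by rewrite addr_ge0 ?divr_ge0 ?exprn_ge0 // mulr_ge0 ?solve_bound_ge0.
have <- : #|{: L.-tuple bool}| = (2 ^ L)%N by rewrite card_tuple card_bool.
apply: (@avg_solve_prob_advice R k N (G N) (L.-tuple bool) (T + k.-1) t
  (fun (d : L.-tuple bool) Ro b => decode_input (inv_out Ro d b r))
  (fun d => inv_reads d r) adv) => //.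
  by rewrite expn_gt0.
by move=> d; apply: inverter_query_solver.
Qed.

End Inverter.

(** * Long advice: the reduction *)

Section SumsetAverage.

Variables (R : realType) (k N : nat) (G : finZmodType).

Implicit Types (a : {ffun 'I_N -> G}) (x : (k.-1).-tuple 'I_N).

Lemma ksum_f_sum_set a x : uniq x -> \sum_(i in [set i in x]) a i = ksum_f a x.
Proof.
move=> ux; rewrite /ksum_f -(big_tuple _ _ x xpredT a) big_uniq //=.
by apply: eq_bigl => i; rewrite inE.
Qed.

Lemma card_set_uniq x : uniq x -> #|[set i in x]| = k.-1.
Proof. by move=> /card_uniqP; rewrite cardsE size_tuple. Qed.

(** Given one such input [x0], all the others are permutations of it, because [x0] does not
    collide. *)
Lemma card_noncolliding a b :
  (#|[set x in ksum_inputs k N | ~~ collides a x & ksum_f a x == b]|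
   <= (k.-1)`!)%N.
Proof.
set X := [set x in _ | _ & _].
case: (pickP (mem X)) => [x0|X0]; last by rewrite eq_card0.
rewrite /X !inE => /and3P[ux0 nc /eqP fx0].
have <- : size (permutations x0) = (k.-1)`!.
  by rewrite size_permutations // size_tuple.
apply: leq_trans (card_preim_seq (permutations x0) (@val_inj _ _ _)).
apply: subset_leq_card; apply/fintype.subsetP => x.
rewrite !inE => /and3P[ux _ /eqP fx]; rewrite mem_permutations.
move: nc; rewrite negb_exists => /forallP /(_ x).
by rewrite fx fx0 eqxx andbT negbK.
Qed.

(* The query distribution counts every sum once, the input distribution counts
   it with multiplicity; they can be compared on sums reached by one subset. *)
Lemma avg_sumset_ge a (g : G -> R) : (forall b, 0 <= g b) ->
  avg (ksum_inputs k N) (fun x => g (ksum_f a x) * (~~ collides a x)%:R)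
  <= avg (sumset k a) g.
Proof.
move=> g0; set In := ksum_inputs k N; set Z := sumset k a.
have fZ x : x \in In -> ksum_f a x \in Z.
  rewrite inE => ux; apply/imsetP; exists [set i in x].
    by rewrite inE card_set_uniq.
  by rewrite ksum_f_sum_set.
have sum_le : \sum_(x in In) g (ksum_f a x) * (~~ collides a x)%:R
    <= ((k.-1)`!)%:R * \sum_(b in Z) g b.
  rewrite (partition_big (ksum_f a) (mem Z)) //= mulr_sumr.
  apply: ler_sum => b _.
  rewrite (eq_bigr (fun x => (~~ collides a x)%:R * g b)); last first.
    by move=> x /andP[_ /eqP ->]; rewrite mulrC.
  rewrite -mulr_suml ler_wpM2r //.
  rewrite -natr_sum ler_nat; apply: leq_trans (card_noncolliding a b).
  rewrite -sum1_card big_mkcond [leqRHS]big_mkcond; apply: leq_sum => x _.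
  rewrite !inE; case: (uniq x) => //=.
  by case: (ksum_f a x == b); case: (collides a x).
(* There are [(k.-1)]! * 'C(N, k.-1)[inputs and at most]'C(N,
   k.-1)[sums, so the multiplicity](k.-1)[!] cancels. *)
have cardIn : #|In| = (N ^_ k.-1)%N.
  have := @card_uniq_tuples 'I_N k.-1 predT; rewrite card_ord => <-.
  by apply: eq_card => x; rewrite !inE all_predT.
have cardZ : (#|Z| <= 'C(N, k.-1))%N.
  by rewrite (leq_trans (leq_imset_card _ _)) // card_draws card_ord.
have sum_ge0 : 0 <= \sum_(b in Z) g b by rewrite sumr_ge0.
rewrite /avg; case: (posnP #|In|) => [->|In0].
  by rewrite invr0 mulr0 divr_ge0.
have Z0 : (0 < #|Z|)%N.
  by case/card_gt0P: In0 => x /fZ fxZ; apply/card_gt0P; exists (ksum_f a x).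
have C0 : (0 < 'C(N, k.-1))%N by apply: leq_trans cardZ.
rewrite ler_pdivrMr ?ltr0n //; apply: (le_trans sum_le).
rewrite mulrAC ler_pdivlMr ?ltr0n // [_%:R * _]mulrC -mulrA ler_wpM2l //.
by rewrite -natrM ler_nat cardIn -bin_ffact mulnC leq_mul2r cardZ orbT.
Qed.

End SumsetAverage.

(** * From an inverter to a kSUM-Indexing algorithm *)

Lemma ler_losses (R : realType) (p t c v e : R) :
  p - t - c - c <= v -> v <= e -> p <= e + t + 2 * c.
Proof. lra. Qed.

Section Reduction.

Variables (R : realType) (k : nat) (G : nat -> finZmodType).
Variables (enc : forall N, G N -> bitseq) (n : nat) (A2 : cmd) (T : nat).

Local Notation N := (2 ^ n)%N.
Local Notation table := {ffun 'I_N -> G N}.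
Local Notation input := ((k.-1).-tuple 'I_N).

(** [q] is the modulus of the residue classes, [Zc] the number of candidate blocks, [B] the block
    length in bits, [ell] the code length of a group element and [L] the length of the data
    structure. A residue class has at most [(N %/ q).+1] members, so [B_large] lets [k.-1] classes
    fit into one block. *)
Variables (A1 : table -> bitseq) (q Zc B ell L : nat).
Hypotheses (q_gt0 : (0 < q)%N) (Zc_gt0 : (0 < Zc)%N).
Hypotheses (ell_gt0 : (0 < ell)%N) (G_small : (#|G N| <= 2 ^ ell)%N).
Hypotheses (B_large : (k.-1 * (N %/ q).+1 * ell <= B)%N).
Hypotheses (blocks_fit : (Zc * B <= L)%N).
Hypothesis size_A1 : forall Ro, (size (A1 Ro) <= L)%N.

Implicit Types (jj : (k.-1).-tuple 'I_q) (z : 'I_Zc) (a u : table) (x : input).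

Definition kept jj : {set 'I_N} :=
  [set i : 'I_N | [exists l, val (tnth jj l) == i %% q]%N].

Lemma card_kept jj : (#|kept jj| * ell <= B)%N.
Proof.
apply: leq_trans B_large; rewrite leq_mul2r; apply/orP; right.
pose s := [seq val (tnth jj l) + y * q | l <- enum 'I_k.-1, y <- iota 0 (N %/ q).+1]%N.
have <- : size s = (k.-1 * (N %/ q).+1)%N.
  by rewrite size_allpairs size_enum_ord size_iota.
apply: leq_trans (card_preim_seq s (@val_inj _ _ 'I_N)).
apply: subset_leq_card; apply/fintype.subsetP => i.
rewrite !inE => /existsP[l /eqP il]; apply/allpairsP.
exists (l, i %/ q)%N; split; first by rewrite mem_enum.
  by rewrite mem_iota /= add0n ltnS leq_div2r // ltnW.
by rewrite il /= addnC -divn_eq.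
Qed.

Definition mix (J : {set 'I_N}) a u : table :=
  [ffun i => if i \in J then a i else u i].

(** Swapping two tables outside [J] is an involution on pairs, so mixing two independent uniform
    tables gives a uniform one. *)
Lemma avg_mix J (F : table -> R) :
  avg [set: table] (fun u => avg [set: table] (fun a => F (mix J a u))) =
  avg [set: table] F.
Proof.
rewrite avgC.
pose h (p : table * table) := (mix J p.1 p.2, mix J p.2 p.1).
have hK : involutive h.
  by move=> [a u]; congr (_, _); apply/ffunP => i; rewrite !ffunE;
    case: (i \in J).
rewrite (avgT2_inv (fun a _ => F a) hK); apply: eq_avg => a _.
by rewrite avg_cst // cardsT; apply/card_gt0P; exists a.
Qed.

(** Unlike [enc], a code of fixed length, so that entries have computable addresses. Efficiency is
    no concern: indexing algorithms are unbounded. *)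
Definition code (g : G N) : bitseq := bits ell (enum_rank g).

Lemma code_inj : injective code.
Proof.
have rank_lt (g : G N) : (enum_rank g < 2 ^ ell)%N.
  by apply: leq_trans (ltn_ord _) G_small.
move=> g h E; apply/enum_rank_inj/val_inj => /=.
by rewrite -(bitsK (rank_lt g)) -(bitsK (rank_lt h)) -/(code g) E.
Qed.

Definition code_inv (v : bitseq) : bitseq :=
  if [pick g | code g == v] is Some g then enc g else [::].

Lemma codeK g : code_inv (code g) = enc g.
Proof.
rewrite /code_inv; case: pickP => [h /eqP /code_inj -> //|].
by move=> /(_ g); rewrite eqxx.
Qed.

(* Block z of the advice is overwritten by the entries of a that are kept. *)
Definition red_bit jj z u a (j : nat) : bool :=
  if (j %/ B == z)%N then
    nth false (nth [::] [seq code (a i) | i <- enum (kept jj)] (j %% B %/ ell))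
      (j %% B %% ell)
  else nth false (A1 (mix (kept jj) a u)) j.

Definition red_data jj z u a : bitseq := mkseq (red_bit jj z u a) L.

Definition red_addrs jj z (i : 'I_N) : seq nat :=
  [seq z * B + (index i (enum (kept jj)) * ell + e) | e <- iota 0 ell]%N.

Lemma read_kept jj z u a i : i \in kept jj ->
  [seq nth false (red_data jj z u a) j | j <- red_addrs jj z i] = code (a i).
Proof.
move=> iJ; apply: (@eq_from_nth _ false).
  by rewrite 2!size_map size_iota size_bits.
move=> e; rewrite 2!size_map size_iota => e_lt.
set p := index i (enum (kept jj)).
have p_lt : (p < #|kept jj|)%N by rewrite cardE index_mem mem_enum.
have off_lt : (p * ell + e < B)%N.
  apply: leq_trans (card_kept jj); apply: (@leq_trans (p.+1 * ell)).
    by rewrite mulSn addnC ltn_add2r.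
  by rewrite leq_mul2r p_lt orbT.
have B_gt0 : (0 < B)%N by apply: leq_trans off_lt.
rewrite (nth_map 0%N) ?size_map ?size_iota //.
have -> : nth 0%N (red_addrs jj z i) e = (z * B + (p * ell + e))%N.
  by rewrite (nth_map 0%N) ?size_iota // nth_iota.
have j_lt : (z * B + (p * ell + e) < L)%N.
  apply: leq_trans blocks_fit; apply: (@leq_trans (z.+1 * B)).
    by rewrite mulSn addnC ltn_add2r.
  by rewrite leq_mul2r ltn_ord orbT.
rewrite nth_mkseq // /red_bit divnMDl // (divn_small off_lt) addn0 eqxx.
rewrite modnMDl (modn_small off_lt) divnMDl // (divn_small e_lt) addn0.
rewrite modnMDl (modn_small e_lt) (nth_map i) -?cardE //.
by rewrite nth_index // mem_enum.
Qed.

(** Kept entries are read from block [z], the others from the shared table [u]. Reads of the advice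
    are passed on and can be wrong only inside block [z]. *)
Definition red_oracle jj z u (o : nat) (v : bitseq) : dtree bitseq :=
  match o with
  | 0 => if [pick i : 'I_N | bits n i == v] is Some i then
           if i \in kept jj
           then dbind (dread (red_addrs jj z i)) (fun v => Answer (code_inv v))
           else Answer (enc (u i))
         else Answer [::]
  | 1 => Probe (nat_of_bits v) (fun b => Answer [:: b])
  | _ => Answer [::]
  end.

Lemma depth_red_oracle jj z u o v : (depth (red_oracle jj z u o v) <= ell)%N.
Proof.
case: o => [|[|o]] //=; case: pickP => // i _; case: ifP => // _.
apply: leq_trans (depth_dbind (d := 0) _ _) _ => //; rewrite addn0.
by apply: leq_trans (depth_dread _) _; rewrite size_map size_iota.
Qed.

Lemma eval_red_oracle jj z u a o v :
  (o = 1%N -> (nat_of_bits v %/ B)%N != z) ->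
  eval_dtree (red_data jj z u a) (red_oracle jj z u o v) =
  rom_oracles enc (mix (kept jj) a u) (A1 (mix (kept jj) a u)) o v.
Proof.
case: o => [|[|o]] //= untouched.
  case: pickP => // i _; rewrite /= ffunE; case: ifP => // iJ.
  by rewrite eval_dbind /= eval_dread read_kept // codeK.
congr [:: _]; case: (ltnP (nat_of_bits v) L) => [vL|Lv].
  by rewrite nth_mkseq // /red_bit (negbTE (untouched _)).
by rewrite !nth_default ?size_mkseq // (leq_trans (size_A1 _)).
Qed.

Definition red_answer (st : state) : {set 'I_N} :=
  if decode_input k n (output st) is Some x then [set i in x] else finset.set0.

Definition red_tree jj z u (r : bitseq) (b : G N) : dtree {set 'I_N} :=
  dbind (dsim (red_oracle jj z u) T (start enc A2 b r))
    (fun st => Answer (red_answer st)).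

Lemma depth_red_tree jj z u r b : (depth (red_tree jj z u r b) <= T * ell)%N.
Proof.
apply: leq_trans (depth_dbind (d := 0) _ _) _ => //; rewrite addn0.
by apply: depth_dsim => o v; apply: depth_red_oracle.
Qed.

Definition touched (Ro : table) x (r : bitseq) : seq nat :=
  [seq (nat_of_bits oq.2 %/ B)%N
    | oq <- inv_trace enc A2 T Ro (A1 Ro) (ksum_f Ro x) r].

Definition matching jj x := [forall l, val (tnth jj l) == tnth x l %% q]%N.

(** A matching [x] has the same value under [a] and [Ro], an untouched block makes the simulation
    faithful, and without collisions the preimage found is a permutation of [x]. *)
Lemma red_tree_correct jj z u r a x : uniq x -> matching jj x ->
  let Ro := mix (kept jj) a u in
  inv_success enc A2 T A1 Ro x r -> val z \notin touched Ro x r ->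
  ~~ collides Ro x ->
  ksum_solution k a (ksum_f a x)
    (eval_dtree (red_data jj z u a) (red_tree jj z u r (ksum_f a x))).
Proof.
move=> ux /forallP jx Ro inv untouched noncoll.
have fx : ksum_f Ro x = ksum_f a x.
  apply: eq_bigr => l _; rewrite ffunE ifT // inE.
  by apply/existsP; exists l; apply: jx.
rewrite /red_tree eval_dbind /= eval_dsim.
have [|<- _] := @iter_agree (rom_oracles enc Ro (A1 Ro))
    (fun o v => eval_dtree (red_data jj z u a) (red_oracle jj z u o v))
    (start enc A2 (ksum_f a x) r) T.
  move=> [] o v ov /=; rewrite eval_red_oracle // => _.
  apply: contra untouched => /eqP zE.
  by apply/mapP; exists (o, v); rewrite ?fx //= zE.
move: inv; rewrite /inv_success invertsE fx /red_answer -/(inv_out _ _ _ _ _ _ _).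
case: decode_input => [x'|//] fx'.
have perm_x : perm_eq x' x.
  move: noncoll; rewrite negb_exists => /forallP /(_ x').
  by rewrite fx (eqP fx') eqxx andbT negbK.
have -> : [set i in x'] = [set i in x].
  by apply/setP => i; rewrite !inE (perm_mem perm_x).
by rewrite /ksum_solution card_set_uniq // ksum_f_sum_set // !eqxx.
Qed.

Definition red_randomness : finType :=
  ('I_Zc * T.-tuple bool * (k.-1).-tuple 'I_q * table)%type.

Lemma card_red_randomness : (0 < #|{: red_randomness}|)%N.
Proof.
apply/card_gt0P.
by exists (Ordinal Zc_gt0, [tuple of nseq T false],
  [tuple of nseq k.-1 (Ordinal q_gt0)], [ffun=> 0]).
Qed.

(** A lower bound for success given as a difference of indicators, so that each loss can be averaged
    separately. *)
Definition red_gain z (r : bitseq) (Ro : table) x : R :=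
  (inv_success enc A2 T A1 Ro x r)%:R - (val z \in touched Ro x r)%:R
  - (collides Ro x)%:R.

(** The gain is evaluated at the mixed table, which is uniform by [avg_mix]. The additional
    collision term, for [a] itself, pays for the passage from random inputs to random sums. *)
Lemma avg_red_solution jj z (r : bitseq) :
  avg (ksum_inputs k N) (fun x => (matching jj x)%:R *
    (avg [set: table] (fun a => red_gain z r a x)
     - avg [set: table] (fun a => (collides a x)%:R)))
  <= avg [set: table] (fun u => avg [set: table] (fun a =>
       avg (sumset k a) (fun b => (ksum_solution k a b
         (eval_dtree (red_data jj z u a) (red_tree jj z u r b)))%:R))).
Proof.
have E x : (matching jj x)%:R * (avg [set: table] (fun a => red_gain z r a x)
     - avg [set: table] (fun a => (collides a x)%:R)) =
  avg [set: table] (fun u => avg [set: table] (fun a =>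
    (matching jj x)%:R *
    (red_gain z r (mix (kept jj) a u) x - (collides a x)%:R))).
  rewrite -(avg_mix (kept jj)) -[X in _ * (_ - X)](@avg_cst _ table [set: table]).
    by rewrite -avgB -avgZ; apply: eq_avg => u _; rewrite -avgB -avgZ.
  by rewrite cardsT; apply/card_gt0P; exists [ffun=> 0].
rewrite (eq_avg (fun x _ => E x)) avgC; apply: ler_avg => u _.
rewrite avgC; apply: ler_avg => a _.
set g := (X in _ <= avg (sumset k a) X).
apply: (@le_trans _ _ (avg (ksum_inputs k N) (fun x =>
  g (ksum_f a x) * (~~ collides a x)%:R))); last exact: avg_sumset_ge.
apply: ler_avg => x; rewrite inE => ux; rewrite /red_gain /g.
case: (boolP (matching jj x)) => jx; last by rewrite mul0r mulr_ge0.
rewrite mul1r; set Ro := mix _ a u.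
case: (boolP (collides a x)) => _ /=; first by
  rewrite mulr0; case: (inv_success _ _ _ _ _ _ _); case: (_ \in _);
  case: (collides _ _); rewrite /=; lra.
rewrite subr0 mulr1.
case: (boolP (inv_success _ _ _ _ _ _ _)) => inv; last first.
  by case: (_ \in _); case: (collides _ _); case: (ksum_solution _ _ _ _);
    rewrite /=; lra.
case: (boolP (val z \in _)) => zt.
  by case: (collides _ _); case: (ksum_solution _ _ _ _); rewrite /=; lra.
case: (boolP (collides Ro x)) => coll.
  by case: (ksum_solution _ _ _ _); rewrite /=; lra.
by rewrite (red_tree_correct ux jx inv zt coll) !subr0.
Qed.

Lemma avg_matching x :
  avg [set: (k.-1).-tuple 'I_q] (fun jj => (matching jj x)%:R : R)
  = ((q ^ k.-1)%:R)^-1.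
Proof.
pose jx : (k.-1).-tuple 'I_q :=
  [tuple Ordinal (ltn_pmod (tnth x l) q_gt0) | l < k.-1].
have E jj : matching jj x = (jj == jx).
  apply/forallP/eqP => [h|-> l]; last by rewrite tnth_mktuple.
  by apply: eq_from_tnth => l; rewrite tnth_mktuple; apply/val_inj/eqP/h.
rewrite /avg (bigD1 jx) ?inE //= E eqxx big1 => [|jj /andP[_]]; last first.
  by rewrite E => /negbTE ->.
by rewrite addr0 mul1r cardsT card_tuple card_ord.
Qed.

(** Even counting the queries to both oracles, at most [T] blocks are touched. *)
Lemma avg_touched (Ro : table) x (r : bitseq) :
  avg [set: 'I_Zc] (fun z => (val z \in touched Ro x r)%:R : R) <= T%:R / Zc%:R.
Proof.
rewrite /avg cardsT card_ord ler_wpM2r ?invr_ge0 //.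
rewrite -natr_sum ler_nat.
have <- : #|[set z : 'I_Zc | val z \in touched Ro x r]| =
    (\sum_(z in [set: 'I_Zc]) (val z \in touched Ro x r))%N.
  rewrite -sum1_card big_mkcond [RHS]big_mkcond; apply: eq_bigr => z _.
  by rewrite !inE; case: (_ \in _).
apply: leq_trans (card_preim_seq _ (@val_inj _ _ 'I_Zc)) _.
by rewrite size_map size_trace.
Qed.

Lemma avg_avg_collides :
  avg (ksum_inputs k N) (fun x =>
    avg [set: table] (fun a => (collides a x)%:R : R))
  <= collision_bound R k N (G N).
Proof.
apply: avg_le_cst => [|x]; first exact: collision_bound_ge0.
by rewrite inE; apply: avg_collides.
Qed.

Lemma inv_prob_long_advice (S eps : R) Tk : L%:R <= S -> (T * ell <= Tk)%N ->
  ksum_indexing_hard k (G N) N S Tk eps ->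
  inv_prob R k enc A2 T A1 <=
  (q ^ k.-1)%:R * eps + T%:R / Zc%:R + 2 * collision_bound R k N (G N).
Proof.
move=> L_S T_Tk hard.
have W_gt0 : 0 < #|{: red_randomness}|%:R :> R.
  by rewrite ltr0n card_red_randomness.
have := hard red_randomness (fun=> #|{: red_randomness}|%:R^-1)
  (fun w a => red_data w.1.2 w.1.1.1 w.2 a)
  (fun w b => red_tree w.1.2 w.1.1.1 w.2 w.1.1.2 b).
have mu_ge0 (w : red_randomness) : 0 <= #|{: red_randomness}|%:R^-1 :> R.
  by rewrite invr_ge0.
have mu_sum : \sum_(w : red_randomness) #|{: red_randomness}|%:R^-1 = 1 :> R.
  by rewrite sumr_const -[_ *+ _]mulr_natl divff // gt_eqF.
move=> /(_ mu_ge0 mu_sum).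
have size_D (w : red_randomness) a :
    (size (red_data w.1.2 w.1.1.1 w.2 a))%:R <= S by rewrite size_mkseq.
have depth_t (w : red_randomness) b :
    (depth (red_tree w.1.2 w.1.1.1 w.2 w.1.1.2 b) <= Tk)%N.
  by apply: leq_trans T_Tk; apply: depth_red_tree.
move=> /(_ size_D depth_t).
rewrite -mulr_sumr mulrC => {}hard.
pose H z (r : bitseq) x := avg [set: table] (fun a => red_gain z r a x)
     - avg [set: table] (fun a => (collides a x)%:R).
have gain : ((q ^ k.-1)%:R)^-1 * avg [set: 'I_Zc] (fun z =>
    avg [set: T.-tuple bool] (fun r => avg (ksum_inputs k N) (H z r))) <= eps.
  apply: le_trans hard.
  set F := (X in \sum_i X i).
  have -> : (\sum_w F w) / #|{: red_randomness}|%:R = avg [set: red_randomness] F.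
    by rewrite /avg cardsT; congr (_ / _); apply: eq_bigl => w; rewrite inE.
  rewrite !avgT_pair -avgZ; apply: ler_avg => z _.
  rewrite -avgZ; apply: ler_avg => r _.
  apply: (@le_trans _ _ (avg [set: (k.-1).-tuple 'I_q] (fun jj =>
    avg (ksum_inputs k N) (fun x => (matching jj x)%:R * H z r x)))); last first.
    by apply: ler_avg => jj _; apply: avg_red_solution.
  rewrite avgC -avgZ; apply: ler_avg => x _.
  by under [leRHS]eq_avg do rewrite mulrC; rewrite avgZ avg_matching mulrC.
have qk_gt0 : 0 < (q ^ k.-1)%:R :> R by rewrite ltr0n expn_gt0 q_gt0.
(* Guessing the residue classes costs the factor [q ^ k.-1]. *)
move: gain; rewrite mulrC ler_pdivrMr // mulrC => gain.
apply: ler_losses gain.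
have Zc0 : (0 < #|[set: 'I_Zc]|)%N by rewrite cardsT card_ord.
have T0 : (0 < #|[set: T.-tuple bool]|)%N.
  by rewrite cardsT card_tuple card_bool expn_gt0.
(* By linearity the losses are split off in turn: collisions under [a], collisions under the mixed
   table, and touching the chosen block. *)
rewrite /H /red_gain.
under [leRHS]eq_avg => z _ do under eq_avg => r _ do rewrite avgB.
under [leRHS]eq_avg => z _ do rewrite avgB.
rewrite avgB; apply: lerB; last first.
  by do 2!(apply: avg_le_cst => [|? _]; first exact: collision_bound_ge0);
    apply: avg_avg_collides.
under [leRHS]eq_avg => z _ do under eq_avg => r _ do
  under eq_avg => x _ do rewrite avgB.
under [leRHS]eq_avg => z _ do under eq_avg => r _ do rewrite avgB.
under [leRHS]eq_avg => z _ do rewrite avgB.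
rewrite avgB; apply: lerB; last first.
  by do 2!(apply: avg_le_cst => [|? _]; first exact: collision_bound_ge0);
    apply: avg_avg_collides.
under [leRHS]eq_avg => z _ do under eq_avg => r _ do
  under eq_avg => x _ do rewrite avgB.
under [leRHS]eq_avg => z _ do under eq_avg => r _ do rewrite avgB.
under [leRHS]eq_avg => z _ do rewrite avgB.
rewrite avgB; apply: lerB.
  rewrite avg_cst // [leRHS]avgC /inv_prob [leLHS]avgC; apply: ler_avg => x _.
  by rewrite [leLHS]avgC.
rewrite avgC; apply: avg_le_cst => [|r _]; first by rewrite divr_ge0.
rewrite avgC; apply: avg_le_cst => [|x _]; first by rewrite divr_ge0.
rewrite avgC; apply: avg_le_cst => [|a _]; first by rewrite divr_ge0.
exact: avg_touched.
Qed.

End Reduction.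

(** * Asymptotics *)

Section Decay.

Variable R : realType.

Implicit Types f g : nat -> R.

(** An eventual one-sided bound of order [n ^- d], convenient for sums and comparisons. *)
Definition decays (d : nat) f : Prop :=
  exists2 C : R, 0 <= C &
    exists n0 : nat, forall n, (n0 <= n)%N -> f n <= C * n%:R ^- d.

Lemma decaysD d f g : decays d f -> decays d g -> decays d (fun n => f n + g n).
Proof.
move=> [C C0 [n1 f_le]] [C' C'0 [n2 g_le]].
exists (C + C'); first exact: addr_ge0.
exists (maxn n1 n2) => n; rewrite geq_max => /andP[h1 h2].
by rewrite mulrDl lerD ?f_le ?g_le.
Qed.

Lemma decaysZ d f c : 0 <= c -> decays d f -> decays d (fun n => c * f n).
Proof.
move=> c0 [C C0 [n1 f_le]]; exists (c * C); first exact: mulr_ge0.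
by exists n1 => n h; rewrite -mulrA ler_wpM2l ?f_le.
Qed.

Lemma decays_le d f g n0 : (forall n, (n0 <= n)%N -> f n <= g n) ->
  decays d g -> decays d f.
Proof.
move=> fg [C C0 [n1 g_le]]; exists C => //; exists (maxn n0 n1) => n.
by rewrite geq_max => /andP[h1 h2]; apply: le_trans (fg _ h1) (g_le _ h2).
Qed.

Lemma decays_inv_power d : decays d (fun n => n%:R ^- d).
Proof. by exists 1 => //; exists 0%N => n _; rewrite mul1r. Qed.

Lemma negligible_decays f : (forall n, 0 <= f n) -> (forall d, decays d f) ->
  negligible_fun f.
Proof.
move=> f0 fd d; apply/eqoP => e e0.
(* The exponent [d.+1] leaves a factor [1 / n], which beats [e / C] for large [n]. *)
have [C C0 [n0 f_le]] := fd d.+1.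
pose n1 := (Num.trunc (C / e)).+1.
exists (maxn n0 n1) => // n /=; rewrite geq_max => /andP[h0 h1].
have n_gt0 : 0 < n%:R :> R by rewrite ltr0n (leq_trans _ h1).
rewrite !ger0_norm ?invr_ge0 ?exprn_ge0 // ?f0 //.
apply: le_trans (f_le _ h0) _; rewrite exprS invfM mulrA.
rewrite ler_wpM2r ?invr_ge0 ?exprn_ge0 // ler_pdivrMr // mulrC -ler_pdivrMr //.
have : C / e < n1%:R by have /andP[] := truncn_itv (divr_ge0 C0 (ltW e0)).
by move=> /ltW h; apply: le_trans h _; rewrite ler_nat.
Qed.

Lemma negligible_norm_decays f d : negligible_fun f -> decays d (fun n => `|f n|).
Proof.
move=> /(_ d) /eqoP /(_ 1 ltr01) [n0 _ f_le].
exists 1 => //; exists n0 => n /f_le; rewrite /= !mul1r.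
by rewrite [X in _ <= X]ger0_norm // invr_ge0 exprn_ge0.
Qed.

Lemma horner_monomial_bound (p : {poly nat}) :
  exists C e : nat, forall n, (0 < n)%N -> (p.[n] <= C * n ^ e)%N.
Proof.
exists (\sum_(i < size p) (p`_i)%R)%N, (size p) => n n0.
rewrite horner_coef big_distrl /=; apply: leq_sum => i _.
have -> : n ^+ i = (n ^ i)%N by elim: (val i) => // m IHm; rewrite exprS IHm expnS.
by rewrite leq_mul2l leq_pexp2l ?orbT // ltnW.
Qed.

Lemma decays_polyM (h : nat -> nat) f : poly_bounded h -> (forall n, 0 <= f n) ->
  (forall d, decays d f) -> forall d, decays d (fun n => (h n)%:R * f n).
Proof.
move=> [p hp] f0 fd d; have [C [e pC]] := horner_monomial_bound p.
have [C' C'0 [n0 f_le]] := fd (e + d)%N.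
exists (C%:R * C'); first exact: mulr_ge0.
exists (maxn 1 n0) => n; rewrite geq_max => /andP[n_gt0 h0].
have n_gt0' : 0 < n%:R :> R by rewrite ltr0n.
apply: (@le_trans _ _ ((C * n ^ e)%:R * (C' * n%:R ^- (e + d)))).
  apply: ler_pM => //; last exact: f_le.
  by rewrite ler_nat (leq_trans (hp n)) ?pC.
rewrite natrM natrX exprD invfM -!mulrA ler_wpM2l //.
rewrite mulrCA ler_wpM2l // mulVKf // lt0r_neq0 // exprn_gt0 //.
Qed.

Lemma decays_powR2 (c : R) d : 0 < c ->
  decays d (fun n => (2 ^ n)%:R `^ (- c)).
Proof.
move=> c0; have b0 : 0 < c * ln 2 by rewrite mulr_gt0 // ln_gt0 // ltr1n.
have fact_gt0' : 0 < (d.+1)`!%:R :> R by rewrite ltr0n fact_gt0.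
exists ((d.+1)`!%:R / (c * ln 2) ^+ d.+1).
  by rewrite divr_ge0 // exprn_ge0 // ltW.
exists 1%N => n n_gt0.
have n_gt0' : 0 < n%:R :> R by rewrite ltr0n.
have -> : (2 ^ n)%:R `^ (- c) = (expR (n%:R * (c * ln 2)))^-1 :> R.
  rewrite powRN /powR natrX gt_eqF ?exprn_gt0 // lnXn // -[ln 2 *+ n]mulr_natl.
  by rewrite mulrCA.
have : (n%:R * (c * ln 2)) ^+ d.+1 / (d.+1)`!%:R <= expR (n%:R * (c * ln 2)).
  have x_ge0 : 0 <= n%:R * (c * ln 2) by rewrite mulr_ge0 // ltW.
  by apply: le_trans (expR_ge1Dxn d x_ge0); rewrite lerDr.
rewrite -[leLHS]invrK invf_ple ?posrE ?expR_gt0 //; last first.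
  by rewrite invr_gt0 divr_gt0 // exprn_gt0 // mulr_gt0.
move=> h; apply: (le_trans h).
rewrite invf_div exprMn invfM [leLHS]mulrCA mulrC ler_wpM2l //.
  by rewrite divr_ge0 // exprn_ge0 // ltW.
rewrite lef_pV2 ?posrE ?exprn_gt0 // exprS ler_peMl ?exprn_ge0 //.
by rewrite ler1n.
Qed.

Lemma decays_inv2 d : decays d (fun n => (2 ^ n)%:R^-1).
Proof.
apply: (decays_le (n0 := 0%N) _ (decays_powR2 d ltr01)) => n _.
by rewrite powR_inv1.
Qed.

Lemma poly_bounded_le_exp2 (h : nat -> nat) : poly_bounded h ->
  exists n0, forall n, (n0 <= n)%N -> (h n <= 2 ^ n)%N.
Proof.
move=> hb.
have inv2_ge0 n : 0 <= (2 ^ n)%:R^-1 :> R by rewrite invr_ge0.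
have [C C0 [n0 le_C]] := decays_polyM hb inv2_ge0 decays_inv2 1.
exists (maxn n0 (Num.trunc C).+1) => n; rewrite geq_max => /andP[h0 h1].
have n_gt0 : 0 < n%:R :> R by rewrite ltr0n (leq_trans _ h1).
have := le_C n h0; rewrite ler_pdivrMr ?ltr0n ?expn_gt0 // => le_h.
rewrite -(ler_nat R); apply: (le_trans le_h).
rewrite ler_piMl // expr1 ler_pdivrMr // mul1r.
have /andP[_ /ltW C_le] := truncn_itv C0.
by apply: (le_trans C_le); rewrite ler_nat.
Qed.

End Decay.

(** * Consequences of the size of the groups *)

Lemma collision_bound_le (R : realType) k N (G : finZmodType) (c : R) :
  (0 < N)%N -> N%:R `^ (k.-1%:R + c) <= #|G|%:R ->
  collision_bound R k N G <= N%:R `^ (- c).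
Proof.
move=> N_gt0 hcard; have N_gt0' : 0 < N%:R :> R by rewrite ltr0n.
rewrite /collision_bound ler_pdivrMr ?cardG_gt0 //.
apply: le_trans (ler_wpM2l (powR_ge0 _ _) hcard).
rewrite -powRD; last by apply/implyP => _; rewrite lt0r_neq0.
by rewrite addrC addrK powR_mulrn // natrX.
Qed.

(** A string is determined by its length and its bits padded to length [m], and [m.+1 <= 2 ^ m]. *)
Lemma card_le_exp2 (I : finType) (e : I -> bitseq) m :
  injective e -> (forall i, (size (e i) <= m)%N) -> (#|I| <= 2 ^ (m + m))%N.
Proof.
move=> e_inj size_e.
pose h i : 'I_m.+1 * m.-tuple bool :=
  (inord (size (e i)), [tuple nth false (e i) j | j < m]).
have h_inj : injective h.
  move=> i i' hE; apply: e_inj.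
  have sizeE : size (e i) = size (e i').
    by have := congr1 (fun y => val y.1) hE; rewrite /= !inordK ?ltnS.
  apply: (@eq_from_nth _ false) => // j jlt.
  have jm : (j < m)%N by apply: leq_trans (size_e i).
  have := congr1 (fun y => tnth y.2 (Ordinal jm)) hE.
  by rewrite !tnth_mktuple.
apply: leq_trans (leq_card h h_inj) _.
rewrite card_prod card_ord card_tuple card_bool expnD leq_mul2r.
by rewrite ltn_expl ?orbT.
Qed.

(** * Choice of parameters and one-wayness *)

Lemma short_arith (R : realType) (x y b t i nd cb : R) :
  x <= y + b * i -> y <= nd -> t <= i ->
  4 * (x + cb) + t <= 4 * nd + (4 * b + 1) * i + 4 * cb.
Proof. lra. Qed.

Lemma final_short_arith (R : realType) (e nd r cb cd : R) :
  cb <= cd -> 0 <= nd -> 0 <= e -> 0 <= cd ->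
  4 * nd + r + 4 * cb <= e + 5 * nd + r + 6 * cd.
Proof. lra. Qed.

Lemma final_long_arith (R : realType) (e nd r cb cd : R) :
  cb <= cd -> 0 <= nd -> 0 <= r -> 0 <= cd ->
  e + nd + 2 * cb <= e + 5 * nd + r + 6 * cd.
Proof. lra. Qed.

Section OneWayness.

Variables (R : realType) (k : nat) (G : nat -> finZmodType).
Variables (enc : forall N, G N -> bitseq) (c : R) (S : nat -> R).
Hypotheses (k3 : (3 <= k)%N) (henc : efficient_groups enc) (c_gt0 : 0 < c).
Hypothesis hcard : forall N : nat, (k.-1 <= N)%N ->
  N%:R `^ (k.-1%:R + c) <= #|G N|%:R.
Hypothesis hard : forall T : {poly nat},
  exists2 eps : nat -> R, negligible_fun eps &
    forall n : nat,
      ksum_indexing_hard k (G (2 ^ n)%N) (2 ^ n)%N (S n) T.[n] (eps n).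

Variable A1 : forall n, {ffun 'I_(2 ^ n) -> G (2 ^ n)%N} -> bitseq.
Variables (A2 : cmd) (p pe : {poly nat}).
Hypothesis size_A1 : forall n Ro, (size (@A1 n Ro))%:R <= S n.
Hypothesis size_enc : forall n (g : G (2 ^ n)%N), (size (enc g) <= pe.[n])%N.

(* d is the exponent aimed at. If the advice has length L with
   L * threshold n < 2^n, the unconditional bound applies; otherwise the
   advice is long enough for the reduction with these parameters. *)
Definition reads n := (p.[n] + k.-1 + k.-1)%N.
Definition threshold d n := (reads n * n ^ d)%N.
Definition code_size n := (pe.[n] + pe.[n]).+1.
Definition nblocks d n := (p.[n].+1 * n ^ d)%N.
(** Large enough for [nblocks d n] blocks to fit into an advice of length at least
    [2 ^ n / threshold d n]. *)
Definition modulus d n :=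
  (2 * k.-1 * code_size n * nblocks d n * threshold d n)%N.

Lemma poly_bounded_reads : poly_bounded reads.
Proof.
apply: poly_boundedD; last exact: poly_boundedC.
by apply: poly_boundedD; [exact: poly_bounded_horner | exact: poly_boundedC].
Qed.

Lemma poly_bounded_modulus d : poly_bounded (modulus d).
Proof.
have nd : poly_bounded (fun n => n ^ d)%N by apply/poly_boundedX/poly_bounded_id.
apply: poly_boundedM; last exact: poly_boundedM poly_bounded_reads nd.
apply: poly_boundedM; last first.
  by apply: poly_boundedM nd; apply/poly_boundedS/poly_bounded_horner.
apply: poly_boundedM; first exact: poly_boundedC.
by apply/poly_boundedS/poly_boundedD; exact: poly_bounded_horner.
Qed.

Lemma k1_gt0 : (0 < k.-1)%N. Proof. by case: k k3 => [|[|]]. Qed.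

Lemma reads_gt0 n : (0 < reads n)%N.
Proof. by rewrite /reads addn_gt0 k1_gt0 orbT. Qed.

Lemma inversion_prob_ge0 n : 0 <= inversion_prob R k enc A1 A2 p n.
Proof. by do 3!apply: avg_ge0 => ? _. Qed.

Lemma inversion_prob_case_short d n : (0 < n)%N ->
  let L := Num.trunc (S n) in
  (L * threshold d n < 2 ^ n)%N ->
  inversion_prob R k enc A1 A2 p n <=
  4 * n%:R ^- d + (4 * (n * reads n + reads n) + 1)%:R * (2 ^ n)%:R^-1
  + 4 * collision_bound R k (2 ^ n) (G (2 ^ n)%N).
Proof.
move=> n_gt0 L short.
have size_L Ro : (size (@A1 n Ro) <= L)%N.
  by rewrite truncn_ge_nat // (le_trans _ (size_A1 Ro)).
apply: le_trans (inv_prob_short_advice R enc A2 p.[n] (L + n) k1_gt0 size_L) _.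
set cb := collision_bound _ _ _ _; set N := (2 ^ n)%N.
have N_gt0 : 0 < N%:R :> R by rewrite ltr0n expn_gt0.
have nd_gt0 : 0 < n%:R ^+ d :> R by rewrite exprn_gt0 // ltr0n.
rewrite /solve_bound -/cb -/(reads n).
(* The only use of the advice being short. *)
have LN : (L * reads n)%:R / N%:R <= n%:R ^- d :> R.
  rewrite ler_pdivrMr // mulrC ler_pdivlMr // -natrX -natrM ler_nat ltnW //.
  by rewrite -mulnA.
(* In the moment [L + n], the part [4 ^+ L] outweighs the number of advice strings and [4 ^+ n] is
   at least [N]. *)
have tail : (2 ^ L)%:R / 4 ^+ (L + n) <= N%:R^-1 :> R.
  rewrite exprD invfM mulrA -[leRHS]mul1r; apply: ler_pM.
  - by rewrite divr_ge0 // exprn_ge0.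
  - by rewrite invr_ge0 exprn_ge0.
  - rewrite ler_pdivrMr ?exprn_gt0 // mul1r natrX.
    by rewrite lerXn2r ?nnegrE // ler_nat.
  - rewrite lef_pV2 ?posrE ?exprn_gt0 // natrX.
    by rewrite lerXn2r ?nnegrE // ler_nat.
have rest : ((L + n) * reads n + (p.[n] + k.-1))%:R / N%:R <=
    (L * reads n)%:R / N%:R + (n * reads n + reads n)%:R / N%:R :> R.
  rewrite -mulrDl ler_wpM2r ?invr_ge0 // -natrD ler_nat mulnDl -addnA.
  by rewrite !leq_add2l leq_addr.
rewrite (natrD _ (4 * _) 1) (natrM _ 4).
exact: short_arith rest LN tail.
Qed.

Lemma inversion_prob_case_long d n (eps : R) : (0 < n)%N ->
  let L := Num.trunc (S n) in
  (2 ^ n <= L * threshold d n)%N -> (modulus d n <= 2 ^ n)%N ->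
  ksum_indexing_hard k (G (2 ^ n)%N) (2 ^ n)%N (S n)
    (p.[n] * code_size n) eps ->
  inversion_prob R k enc A1 A2 p n <=
  (modulus d n ^ k.-1)%:R * `|eps| + n%:R ^- d
  + 2 * collision_bound R k (2 ^ n) (G (2 ^ n)%N).
Proof.
move=> n_gt0 L long mod_le hard_n.
have S_ge0 : 0 <= S n by apply: le_trans (size_A1 [ffun=> 0]).
have size_L Ro : (size (@A1 n Ro) <= L)%N.
  by rewrite truncn_ge_nat.
have L_S : L%:R <= S n by rewrite truncn_le.
have nd_gt0 : (0 < n ^ d)%N by rewrite expn_gt0 n_gt0.
have thr_gt0 : (0 < threshold d n)%N by rewrite muln_gt0 reads_gt0.
have nb_gt0 : (0 < nblocks d n)%N by rewrite muln_gt0.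
have mod_gt0 : (0 < modulus d n)%N.
  by rewrite /modulus 2!(muln_gt0 (_ * _)) thr_gt0 nb_gt0 !muln_gt0 k1_gt0.
have G_small : (#|G (2 ^ n)%N| <= 2 ^ code_size n)%N.
  have [enc_inj _ _] := henc.
  apply: leq_trans (card_le_exp2 (enc_inj n) (@size_enc n)) _.
  by rewrite leq_exp2l.
set B := (k.-1 * (2 ^ n %/ modulus d n).+1 * code_size n)%N.
have fit : (nblocks d n * B <= L)%N.
  rewrite -(leq_pmul2r thr_gt0); apply: leq_trans long.
  set m := (2 ^ n %/ modulus d n)%N in B *.
  have m_gt0 : (0 < m)%N by rewrite divn_gt0.
  apply: leq_trans (leq_trunc_div _ (modulus d n)); rewrite -/m /B /modulus.
  (* The factor 2 in [modulus] absorbs the rounding in the block size. *)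
  have m2 : (m.+1 <= 2 * m)%N by lia.
  have -> : (m * (2 * k.-1 * code_size n * nblocks d n * threshold d n) =
    nblocks d n * (k.-1 * (2 * m) * code_size n) * threshold d n)%N by lia.
  by rewrite leq_mul2r leq_mul2l leq_mul2r leq_mul2l m2 !orbT.
apply: le_trans (@inv_prob_long_advice R k G enc n A2 p.[n] (@A1 n) _ _ B _ L
  mod_gt0 nb_gt0 (ltn0Sn _) G_small (leqnn B) fit size_L _ _ _ L_S (leqnn _)
  hard_n) _.
rewrite lerD2r lerD //.
  by rewrite ler_wpM2l // ler_norm.
(* The factor [n ^ d] in [nblocks] makes the chance of touching the chosen block at most
   [n ^- d]. *)
rewrite ler_pdivrMr ?ltr0n // mulrC natrM natrX.
rewrite mulfK ?expf_neq0 ?pnatr_eq0 -?lt0n //.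
by rewrite ler_nat.
Qed.

Lemma decays_inversion_prob d : decays d (inversion_prob R k enc A1 A2 p).
Proof.
(* Probe budget of the reduction: [p.[n]] simulated steps with at most [code_size n] probes each. *)
have [eps eps_negl hard_eps] := hard (p * (pe + pe + 1)).
have [n1 mod_le] := poly_bounded_le_exp2 R (poly_bounded_modulus d).
pose cd n : R := (2 ^ n)%:R `^ (- c).
(* A common upper bound for both cases, since the case may vary with [n]. *)
pose g n : R := (modulus d n ^ k.-1)%:R * `|eps n| + 5 * n%:R ^- d
  + (4 * (n * reads n + reads n) + 1)%:R * (2 ^ n)%:R^-1 + 6 * cd n.
apply: (@decays_le _ _ _ g (maxn (maxn n1 k) 1)); last first.
  rewrite /g; do 3?apply: decaysD.
  - apply: decays_polyM => // [|d'];
      last exact: negligible_norm_decays.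
    exact/poly_boundedX/poly_bounded_modulus.
  - by apply: decaysZ => //; exact: decays_inv_power.
  - apply: decays_polyM => [|n|d']; last exact: decays_inv2.
      apply: poly_boundedD (poly_boundedC _); apply: poly_boundedM (poly_boundedC _) _.
      apply: poly_boundedD poly_bounded_reads.
      exact: poly_boundedM poly_bounded_id poly_bounded_reads.
    by rewrite invr_ge0.
  - by apply: decaysZ => //; exact: decays_powR2.
move=> n; rewrite !geq_max => /andP[/andP[h1 hk] n_gt0].
have cb_le : collision_bound R k (2 ^ n) (G (2 ^ n)%N) <= cd n.
  apply: collision_bound_le; first by rewrite expn_gt0.
  (* From [k <= n] follows [k.-1 <= 2 ^ n], as the bound on the group size requires. *)
  apply: hcard; apply: leq_trans (leq_pred _) _.
  by rewrite (leq_trans hk) // ltnW // ltn_expl.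
have nd_ge0 : 0 <= n%:R ^- d :> R by rewrite invr_ge0 exprn_ge0.
have e_ge0 : 0 <= (modulus d n ^ k.-1)%:R * `|eps n| by rewrite mulr_ge0.
have r_ge0 : 0 <= (4 * (n * reads n + reads n) + 1)%:R * (2 ^ n)%:R^-1 :> R.
  by rewrite mulr_ge0 // invr_ge0.
have cd_ge0 : 0 <= cd n by exact: powR_ge0.
case: (ltnP (Num.trunc (S n) * threshold d n) (2 ^ n)) => [short|long].
  apply: le_trans (inversion_prob_case_short n_gt0 short) _.
  exact: final_short_arith.
have hard_n := hard_eps n.
have ET : (p * (pe + pe + 1)).[n] = (p.[n] * code_size n)%N.
  by rewrite hornerM !hornerD hornerC /code_size -addn1.
rewrite ET in hard_n.
apply: le_trans (inversion_prob_case_long n_gt0 long (mod_le _ h1) hard_n) _.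
exact: final_long_arith.
Qed.

End OneWayness.

Unset Implicit Arguments.

Theorem theorem5p9 (R : realType) (k : nat) (hk : (3 <= k)%N)
    (G : nat -> finZmodType) (enc : forall N, G N -> bitseq)
    (henc : efficient_groups enc)
    (c : R) (hc : 0 < c)
    (hcard : forall N : nat, (k.-1 <= N)%N ->
       N%:R `^ (k.-1%:R + c) <= #|G N|%:R)
    (S : nat -> R)
    (hard : forall T : {poly nat},
       exists2 eps : nat -> R, negligible_fun eps &
         forall n : nat,
           ksum_indexing_hard k (G (2 ^ n)%N) (2 ^ n)%N (S n) T.[n] (eps n)) :
  ksum_f_one_way k enc S.
Proof.
split; first exact: efficient_ksum_f.
move=> A1 A2 p size_A1 _; have [_ [pe size_enc] _] := henc.
apply: negligible_decays => [n|d]; first exact: inversion_prob_ge0.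
exact: (decays_inversion_prob hk henc hc hcard hard A2 p size_A1 size_enc d).
Qed.
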